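(* Let $n\ge 3$, let $k\in[n]$, and let $f_k:Q_n\to\mathbb{R}$ be the function with $f_k\big(\sum_S\lambda_Sv_S\big)=\sum_S\lambda_S$ for positive representations with respect to $V_k$. Then the divisor of (the restriction of) $f_k$ on $\mathcal{M}_{0,n}\subset Q_n$ is $$\operatorname{div}(f_k)=\binom{n-1}{2}\,\Psi_k,$$ where $\Psi_k$ is the $k$-th tropical Psi-class.
   Context: Let $n\ge 3$ be an integer and $[n]=\{1,\dots,n\}$. **Tropical curves and $\mathcal{M}_{0,n}$.** An $n$-marked (rational) abstract tropical curve is a tree without 2-valent vertices, with $n$ leaves (unbounded edges) labeled $1,\dots,n$, together with a positive real length for each bounded (non-leaf) edge. Its combinatorial type is the underlying labeled tree without lengths. $\mathcal{M}_{0,n}$ is the set of all such curves; curves of a fixed type with $r$ bounded edges form an open cone $\mathbb{R}_{>0}^r$, and cones are glued so that faces correspond to contracting bounded edges. **Embedding.** Let $\mathcal{T}$ be the set of two-element subsets of $[n]$, $\Phi_n:\mathbb{R}^n\to\mathbb{R}^{\binom n2}$, $a\mapsto(a_i+a_j)_{\{i,j\}\in\mathcal{T}}$, and $Q_n=\mathbb{R}^{\binom n2}/\operatorname{im}(\Phi_n)$. The map $\varphi_n:\mathcal{M}_{0,n}\to Q_n$ sends $C$ to the class of $(\operatorname{dist}(\{i,j\}))_{\{i,j\}}$, where $\operatorname{dist}(\{i,j\})$ is the sum of the lengths of the bounded edges on the path between leaves $i$ and $j$. For $I\subset[n]$ let $v_I\in\mathbb{R}^{\binom n2}$ (and its class in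 $Q_n$) be given by $(v_I)_T=1$ if $|I\cap T|=1$ and $(v_I)_T=0$ otherwise. For $1<|I|<n-1$, $v_I=v_{[n]\setminus I}$ is the image of the tree with one bounded edge of length one separating the labels in $I$ from those in $[n]\setminus I$. It is known that $\varphi_n$ embeds $\mathcal{M}_{0,n}$ as a pure $(n-3)$-dimensional simplicial balanced fan, all facets having weight 1, with respect to the lattice in $Q_n$ generated by the $v_I$. The closed cone of a combinatorial type is generated by the $v_I$ with $I$ running over the splits of $[n]$ given by its bounded edges. If a cone $\tau$ is a codimension-one face of a cone $\sigma$, the primitive vector $u_{\sigma/\tau}$ is $v_I$, where $I$ is the split given by the edge contracted in passing from $\sigma$ to $\tau$. **Divisors.** Let $\varphi$ be a continuous function on $\mathcal{M}_{0,n}\subset Q_n$ that is linear on each cone. For a cone $\sigma$ let $\varphi_\sigma$ be the linear function on the span of $\sigma$ that agrees with $\varphi$ on $\sigma$. The divisor $\operatorname{div}(\varphi)$ is the codimension-one skeleton of $\mathcal{M}_{0,n}$ with weights $$\omega(\tau)=\sum_{\sigma\supset\tau}\varphi_\sigma\big(u_{\sigma/\tau}\big)-\varphi_\tau\Big(\sum_{\sigma\supset\tau}u_{\sigma/\tau}\Big),$$ the sums running over the facets $\sigma$ of $\mathcal{M}_{0,n}$ containing $\tau$ (all of weight 1); cones of weight 0 are discarded. **Functions $f_k$.** $V_k=\{v_S : S\subset[n]\setminus\{k\},\ |S|=2\}$. Every $v\in Q_n$ has a unique positive representation with respect to $V_k$, i.e. $v=\sum_{v_S\in V_k}\lambda_Sv_S$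 with all $\lambda_S\ge0$ and at least one $\lambda_S=0$; so $f_k$ is well defined. It is linear on every cone of $\mathcal{M}_{0,n}$. **Psi-classes.** $\Psi_k$ is the weighted fan consisting of those closed $(n-4)$-dimensional cones of $\mathcal{M}_{0,n}$ corresponding to tropical curves in which the leaf labeled $k$ is adjacent to a vertex of valence 4, each cone having weight 1. $\binom{n-1}{2}\Psi_k$ is the same fan with all weights multiplied by $\binom{n-1}{2}$. *)

(* Defs.v *)
From HB Require Import structures.
From mathcomp Require Import all_boot all_order all_algebra.
From mathcomp Require Import generic_quotient ring_quotient.
From mathcomp Require Import boolp classical_sets functions cardinality fsbigop.
From mathcomp Require Import reals.

Set Implicit Arguments.
Unset Strict Implicit.
Unset Printing Implicit Defensive.

Import Order.TTheory GRing.Theory Num.Theory.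

Local Open Scope ring_scope.
Local Open Scope quotient_scope.
Local Open Scope classical_set_scope.

Section VspaceQuotient.
Variables (K : fieldType) (V : vectType K) (S : {vspace V}).
Local Notation Q := (Quotient.quot S).

Definition quot_scale (a : K) : Q -> Q := lift_op1 Q (fun x => a *: x).

Lemma pi_quot_scale a : {morph \pi_Q : x / a *: x >-> quot_scale a x}.
Proof.
move=> x; unlock quot_scale; apply/eqP.
by rewrite piE Quotient.equivE -scalerBr rpredZ // Quotient.idealrBE reprK.
Qed.

Lemma quot_scaleA a b (x : Q) :
  quot_scale a (quot_scale b x) = quot_scale (a * b) x.
Proof. by elim/quotW: x => x; rewrite -!pi_quot_scale scalerA. Qed.

Lemma quot_scale1 : left_id 1 quot_scale.
Proof. by elim/quotW=> x; rewrite -pi_quot_scale scale1r. Qed.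

Lemma quot_scaleDr : right_distributive quot_scale +%R.
Proof.
move=> a; elim/quotW=> x; elim/quotW=> y.
by rewrite -raddfD -!pi_quot_scale scalerDr raddfD.
Qed.

Lemma quot_scaleDl (x : Q) : {morph quot_scale^~ x : a b / a + b}.
Proof.
elim/quotW: x => x a b.
by rewrite -!pi_quot_scale scalerDl raddfD.
Qed.

HB.instance Definition _ := GRing.Zmodule_isLmodule.Build K Q
  quot_scaleA quot_scale1 quot_scaleDr quot_scaleDl.

End VspaceQuotient.

Definition pair2 (n : nat) : predArgType := {T : {set 'I_n} | #|T| == 2%N}.
HB.instance Definition _ n := SubFinite.on (pair2 n).

Section Ambient.
Variables (R : realType) (n : nat).

Definition Phi (a : {ffun 'I_n -> R^o}) : {ffun pair2 n -> R^o} :=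
  [ffun T : pair2 n => \sum_(i in val T) a i].

Fact Phi_is_linear : linear Phi.
Proof.
move=> c a b; apply/ffunP=> T; rewrite !ffunE scaler_sumr -big_split /=.
by apply: eq_bigr => i _; rewrite !ffunE.
Qed.
HB.instance Definition _ :=
  GRing.isLinear.Build R {ffun 'I_n -> R^o} {ffun pair2 n -> R^o} *:%R Phi
    Phi_is_linear.

Definition Qspace : Type := Quotient.quot (limg (linfun Phi)).
HB.instance Definition _ := GRing.Lmodule.on Qspace.

Definition toQ (d : {ffun pair2 n -> R^o}) : Qspace :=
  \pi_(Quotient.quot (limg (linfun Phi))) d.

Fact toQ_is_linear : linear toQ.
Proof. by move=> a x y; rewrite /toQ raddfD /= pi_quot_scale. Qed.
HB.instance Definition _ :=
  GRing.isLinear.Build R {ffun pair2 n -> R^o} Qspace *:%R toQ toQ_is_linear.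

Definition v_ (I : {set 'I_n}) : Qspace :=
  toQ [ffun T : pair2 n => (#|I :&: val T| == 1%N)%:R].

End Ambient.

(* A combinatorial type of n-marked curves.  The unbounded edges are the edges
   at the 1-valent vertices, so the other edges are the bounded ones.  For
   ucycle an edge followed back and forth is a cycle of length 2, whence the
   bound in adj_acyclic. *)
Record tree (n : nat) := Tree {
  vert : finType;
  adj : rel vert;
  adj_sym : symmetric adj;
  adj_irr : irreflexive adj;
  adj_connected : forall x y, connect adj x y;
  adj_acyclic : forall p : seq vert, ucycle adj p -> (size p <= 2)%N;
  leaf : 'I_n -> vert;
  leaf_inj : injective leaf;
  leafP : forall x, (x \in codom leaf) = (#|adj x| == 1%N);
  not_2valent : forall x, #|adj x| != 2%N
}.

Section Types.
Variables (n : nat) (T : tree n).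
Implicit Types x y : vert T.

Definition valence x := #|adj x|.

Definition bounded x y : bool :=
  [&& adj x y, valence x != 1%N & valence y != 1%N].

Definition nb_bounded : nat :=
  #|[set [set e.1; e.2]%SET | e : vert T * vert T & bounded e.1 e.2]|.

(* The labels that stay on the side of x when the edge xy is removed. *)
Definition side x y : {set 'I_n} :=
  [set i | connect [rel a b | adj a b && ([set a; b]%SET != [set x; y]%SET)]
                   x (leaf T i)]%SET.

(* Each split is listed with both of its sides; v_ does not distinguish them. *)
Definition splits : {set {set 'I_n}} :=
  [set side e.1 e.2 | e : vert T * vert T & bounded e.1 e.2]%SET.

End Types.

Section Fan.
Variables (R : realType) (n : nat).
Local Notation Q := (Qspace R n).

Definition cone (T : tree n) : set Q :=
  [set x | exists2 c : {set 'I_n} -> R, (forall I, 0 <= c I) &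
           x = \sum_(I in splits T) c I *: v_ R I].

Definition cones_of_dim (r : nat) : set (set Q) :=
  [set s | exists2 T : tree n, nb_bounded T = r & s = cone T].

Definition facet : set (set Q) := cones_of_dim (n - 3).

(* The condition is r + 1 = n - 3, so that there are no such cones for n = 3. *)
Definition codim1 : set (set Q) :=
  [set t | exists2 r, r.+1 = (n - 3)%N & cones_of_dim r t].

(* The contracted edge is the bounded edge of S whose split is not one of T. *)
Definition primitive (s t : set Q) : Q :=
  xget 0 [set u | exists S T I,
    [/\ s = cone S, t = cone T, I \in splits S :\: splits T & u = v_ R I]].

(* Only the values of phi_s on the span of s matter; they do not depend on the
   linear extension chosen. *)
Definition linear_on (phi : Q -> R) (s : set Q) : Q -> R :=
  xget (fun=> 0) [set L : Q -> R | scalar L /\ {in s, L =1 phi}].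

(* A weighted fan is the set of its cones of nonzero weight, each paired with
   its weight. *)
Definition weighted_fan := set (set Q * R).

Definition star (t : set Q) : set (set Q) := [set s | facet s /\ t `<=` s].

Definition weight (phi : Q -> R) (t : set Q) : R :=
  \sum_(s \in star t) linear_on phi s (primitive s t)
  - linear_on phi t (\sum_(s \in star t) primitive s t).

Definition divisor (phi : Q -> R) : weighted_fan :=
  [set X | [/\ codim1 X.1, X.2 = weight phi X.1 & X.2 != 0]].

Definition scale_fan (c : R) (X : weighted_fan) : weighted_fan :=
  [set (x.1, c * x.2) | x in X].

Definition V_ (k : 'I_n) : {set {set 'I_n}} :=
  [set S : {set 'I_n} | (S \subset [set~ k]%SET) && (#|S| == 2%N)]%SET.

Definition positive_rep (k : 'I_n) (x : Q) (l : {set 'I_n} -> R) : Prop :=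
  [/\ x = \sum_(S in V_ k) l S *: v_ R S,
      forall S, S \in V_ k -> 0 <= l S
    & exists2 S, S \in V_ k & l S = 0].

(* A positive representation exists and is unique when n >= 3. *)
Definition f_ (k : 'I_n) (x : Q) : R :=
  xget 0 [set r | exists2 l, positive_rep k x l & r = \sum_(S in V_ k) l S].

Definition Psi (k : 'I_n) : weighted_fan :=
  [set X | exists T : tree n,
    [/\ (nb_bounded T + 4 = n)%N,
        exists2 x, adj (leaf T k) x & valence x = 4,
        X.1 = cone T & X.2 = 1]].

End Fan.

Arguments f_ R {n} k x.
Arguments Psi R {n} k.

(* Main.v *)
(* A split system is the system of a curve as soon as it is closed under
   complement, pairwise compatible and free of trivial splits (Buneman), and the
   cone determines the splits, since the functional
   d(i,p) + d(j,q) - d(i,j) - d(p,q) detects the splits separating ij from pq.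
   A curve with n - 4 bounded edges has exactly one 4-valent vertex, the other
   inner ones being 3-valent.  With A, B, C, D the label sets of its four
   branches and k in D, a further compatible split not containing k is A u B,
   A u C or B u C, so the star consists of three facets, and
     v_AB + v_AC + v_BC = v_A + v_B + v_C + v_ABC   in Q_n.
   As v_I is the sum of the v_S over the pairs S inside I when k is not in I,
   f_k(v_I) = C(|I|, 2) for the splits, and the weight is
     C(a+b,2) + C(a+c,2) + C(b+c,2) - C(a,2) - C(b,2) - C(c,2) - C(a+b+c,2) = 0,
   except that v_ABC = v_D = 0 if D = {k}: then the last term is missing and
   the weight is C(a+b+c, 2) = C(n-1, 2). *)

Require Import Defs.
From mathcomp Require Import boolp classical_sets fsbigop.
From mathcomp Require Import all_boot all_order all_algebra.
From mathcomp Require Import generic_quotient ring_quotient.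
From mathcomp Require Import reals.
From mathcomp Require Import zify ring lra.

Set Implicit Arguments.
Unset Strict Implicit.
Unset Printing Implicit Defensive.

Import Order.TTheory GRing.Theory Num.Theory.

(** The vectors of V_k sum to zero in Q_n, so a coefficient with respect to V_k is not a function of
    the point; only differences of coefficients are, and they are differences of Gromov products
    based at k. Two facts make f_k computable from this. On a given cone one pair {i, j} has
    coefficient zero for all splits at once: take labels from two branches, other than k itself, at
    the neighbour of the leaf k. Hence expanding each v_I over V_k already gives a positive
    representation, and subtracting the coefficient of {i, j} extends f_k from the cone to a linear
    function on Q_n. The function chosen by [linear_on] is known only on its cone. The sum of the
    primitive vectors around a cone must therefore be rewritten by the balancing relation into
    vectors of that cone before the function can be evaluated. A new split J can only resolve the
    4-valent vertex: at a vertex none of whose branches is cut by J, at least two branches lie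
    inside J and two outside, which a 3-valent vertex does not allow. *)

Lemma eq_set2 (U : finType) (a b x y : U) :
  ([set a; b] == [set x; y]) = (a == x) && (b == y) || (a == y) && (b == x).
Proof.
apply/eqP/orP => [E|[]/andP[/eqP-> /eqP->]] //; last by rewrite setUC.
have: a \in [set x; y] by rewrite -E set21.
have: b \in [set x; y] by rewrite -E set22.
have: x \in [set a; b] by rewrite E set21.
have: y \in [set a; b] by rewrite E set22.
rewrite !inE ![y == _]eq_sym ![x == _]eq_sym.
by do 4 case: (_ == _) => //; auto.
Qed.

(** Equivalently, one of the four intersections of a side of I with a side of J is empty. *)
Definition compat (n : nat) (I J : {set 'I_n}) :=
  [|| I \subset J, I \subset ~: J, ~: I \subset J | ~: I \subset ~: J].

(** * Sides of edges and splits of a tree *)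

Section TreeTheory.
Variables (n : nat) (T : tree n).
Implicit Types x y z a b : vert T.

(* The vertices on the side of x of the edge xy; locked to stop inE from
   unfolding it. *)
Definition component x y : {set vert T} :=
  locked [set z | connect [rel a b | adj a b && ([set a; b] != [set x; y])] x z].

Lemma in_comp x y z : (z \in component x y) =
  connect [rel a b | adj a b && ([set a; b] != [set x; y])] x z.
Proof. by rewrite /component -lock inE. Qed.

Lemma in_side x y i : (i \in side x y) = (leaf T i \in component x y).
Proof. by rewrite in_comp inE. Qed.

Lemma adjC x y : adj x y = adj y x.
Proof. exact: adj_sym. Qed.

Lemma comp_refl x y : x \in component x y.
Proof. by rewrite in_comp connect0. Qed.

Lemma comp_step x y a b :
  a \in component x y -> adj a b -> [set a; b] != [set x; y] -> b \in component x y.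
Proof.
rewrite !in_comp => ca ab ne; apply: connect_trans ca _.
by apply: connect1; rewrite /= ab.
Qed.

Lemma comp_ind x y (A : {pred vert T}) : x \in A ->
  (forall a b, a \in component x y -> a \in A -> adj a b ->
     [set a; b] != [set x; y] -> b \in A) ->
  {subset component x y <= A}.
Proof.
move=> Ax step z; rewrite in_comp => /connectP[p pp ->].
suff: forall a, a \in component x y -> a \in A ->
  path [rel a b | adj a b && ([set a; b] != [set x; y])] a p -> last a p \in A.
  by apply=> //; rewrite comp_refl.
elim: p {pp} => //= b p IHp a ca Aa /andP[/andP[ab ne] pp].
by apply: (IHp b) => //; [apply: comp_step ca _ _ | apply: step Aa _ _].
Qed.

(** A simple path from x to y avoiding the edge xy would close up with it to a cycle. The bound on
    cycles leaves only the path of length one, which is the excluded edge itself. *)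
Lemma comp_notin x y : adj x y -> y \notin component x y.
Proof.
move=> xy; apply/negP; rewrite in_comp => /connectP[p0 pp0 e0].
move: e0; case/shortenP: pp0 => p pp up _ e.
have := @adj_acyclic _ T (x :: p).
rewrite /ucycle up andbT /= rcons_path -e adj_sym xy andbT.
have -> : path (@adj _ T) x p.
  by apply: sub_path pp => a b /= /andP[].
move=> /(_ isT); case: p pp up e => [|a [|b p]] //=.
  by move=> _ _ e; move: xy; rewrite e adj_irr.
by move=> /andP[/andP[_ /eqP ne]] _ _ e; case: ne; rewrite e.
Qed.

(** Along a path from x, a step over the edge xy lands at x or y, and any other step stays in the
    current component. *)
Lemma compU x y z : (z \in component x y) || (z \in component y x).
Proof.
have /connectP[p pp ->] := adj_connected x z.
suff: forall p a, (a \in component x y) || (a \in component y x) -> path (@adj _ T) a p ->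
  (last a p \in component x y) || (last a p \in component y x).
  by apply=> //; rewrite comp_refl.
elim=> //= {pp} b {}p IHp a ca /andP[ab pp]; apply: IHp => //.
have [/eqP|ne] := boolP ([set a; b] == [set x; y]).
  move/eqP; rewrite eq_set2 => /orP[]/andP[_ /eqP->]; by rewrite comp_refl ?orbT.
case/orP: ca => /comp_step/(_ ab) h; first by rewrite h.
by rewrite h ?orbT // [[set y; x]]setUC.
Qed.

Lemma comp_sym x y a b : a \in component x y -> b \in component x y ->
  connect [rel a b | adj a b && ([set a; b] != [set x; y])] a b.
Proof.
rewrite !in_comp => ca cb; apply: connect_trans cb; rewrite sym_connect_sym //.
by move=> u v /=; rewrite adj_sym [[set u; v]]setUC.
Qed.

Lemma compC x y : adj x y -> component y x = ~: component x y.
Proof.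
move=> xy; apply/setP=> z; rewrite in_setC.
apply/idP/idP => [zy|]; last by have /orP[->|->] := compU x y z.
apply/negP=> zx; have := comp_notin xy; rewrite in_comp.
rewrite (connect_trans (comp_sym (comp_refl x y) zx)) //.
have := comp_sym zy (comp_refl y x); rewrite [[set y; x]]setUC //.
Qed.

Lemma sideC x y : adj x y -> side y x = ~: side x y.
Proof.
by move=> xy; apply/setP=> i; rewrite in_setC !in_side compC ?in_setC.
Qed.

Lemma cross x y a b : adj a b -> adj x y ->
  a \in component x y -> b \notin component x y -> a = x /\ b = y.
Proof.
move=> ab xy ca cb; have := contra (comp_step ca ab) cb.
rewrite negbK eq_set2 => /orP[/andP[/eqP-> /eqP->]//|/andP[/eqP ay _]].
by move: ca (comp_notin xy); rewrite ay => ->.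
Qed.

(** A walk starting at b could leave [component x y] only over the edge xy, that is, by reaching
    y. *)
Lemma comp_subset x y a b :
  b \in component x y -> y \notin component b a -> component b a \subset component x y.
Proof.
move=> cb ny; apply/subsetP; apply: comp_ind => // u v cu cxu uv ne.
have [e|ne2] := boolP ([set u; v] == [set x; y]); last exact: comp_step uv _.
have cv := comp_step cu uv ne.
move: e; rewrite eq_set2 => /orP[]/andP[/eqP e1 /eqP e2]; subst.
  by rewrite cv in ny.
by rewrite comp_refl.
Qed.

Lemma branch_exists x z : x != z -> exists2 y, adj x y & z \in component y x.
Proof.
move=> xz; have /connectP[p0 pp0 e0] := adj_connected x z.
move: e0; case/shortenP: pp0 => p pp up _ e.
case: p e pp up => [/eqP|y p /= ->]; first by rewrite eq_sym (negbTE xz).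
move=> /andP[xy pp] /andP[nx _]; exists y => //; rewrite in_comp; apply/connectP.
exists p => //; apply: sub_in_path (pp); last first.
  rewrite -/(all _ (y :: p)); apply/allP => u up; apply: (_ : u \in predC1 x).
  by rewrite inE; apply: contraNneq nx => <-.
move=> a b; rewrite !inE => ax bx ab /=.
by rewrite ab eq_set2 (negbTE ax) (negbTE bx) andbF.
Qed.

Lemma branch_subset x y z : adj x y -> adj x z -> y != z -> component z x \subset component x y.
Proof.
move=> xy xz yz; apply: comp_subset.
  apply: comp_step (comp_refl x y) xz _; rewrite eq_set2 eqxx /= negb_or eq_sym yz.
  by apply: contraTN xy => /andP[/eqP<-]; rewrite adj_irr.
rewrite (compC xz) inE negbK; apply: comp_step (comp_refl x z) xy _.
rewrite eq_set2 eqxx /= negb_or yz.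
by apply: contraTN xz => /andP[/eqP<-]; rewrite adj_irr.
Qed.

Lemma branch_disjoint x y z u : adj x y -> adj x z ->
  u \in component y x -> u \in component z x -> y = z.
Proof.
move=> xy xz uy uz; apply/eqP/negPn/negP => /(branch_subset xy xz)/subsetP/(_ _ uz).
by rewrite -[_ \in _]negbK -in_setC -(compC xy) uy.
Qed.

Lemma edge_branch x a b : x \notin component b a ->
  exists2 y, adj x y & component b a \subset component y x.
Proof.
move=> xb; have /branch_exists[y xy byx] : x != b.
  by apply: contraNneq xb => ->; rewrite comp_refl.
by exists y => //; apply: comp_subset.
Qed.

(** By [comp_subset] each case nests a side of ab in a side of xy, which is the source of
    compatibility. If no case held, one edge would join the two sides of the other, and [cross]
    would identify their ends. *)
Lemma edges_nested x y a b : adj x y -> adj a b ->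
  [\/ (b \in component x y) && (y \notin component b a),
      (a \in component x y) && (y \notin component a b),
      (b \in component y x) && (x \notin component b a) |
      (a \in component y x) && (x \notin component a b)].
Proof.
move=> xy ab; rewrite (compC xy) (compC ab) !in_setC !negbK.
have c1 := cross ab xy; have c2 := cross (etrans (adjC b a) ab) xy.
have c3 := cross xy ab; have c4 := cross (etrans (adjC y x) xy) ab.
have := comp_refl x y; have := comp_refl a b.
have := comp_notin xy; have := comp_notin ab.
case ax: (a \in component x y); case bx: (b \in component x y);
case xa: (x \in component a b); case ya: (y \in component a b) => // nb ny aa xx;
try by [constructor 1 | constructor 2 | constructor 3 | constructor 4].
- by case: (c1 ax); rewrite ?bx // => ? ?; subst; rewrite aa in xa.
- by case: (c2 bx); rewrite ?ax // => ? ?; subst; rewrite aa in ya.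
Qed.

(** * Leaves, inner vertices and the splits of bounded edges *)

Definition is_leaf x := x \in codom (leaf T).

Lemma is_leafE x : is_leaf x = (valence x == 1%N).
Proof. exact: leafP. Qed.

Lemma is_leaf_leaf i : is_leaf (leaf T i).
Proof. exact: codom_f. Qed.

Lemma valenceE x : valence x = #|[set y | adj x y]|.
Proof. by rewrite cardsE. Qed.

Lemma two_others x y : ~~ is_leaf x -> adj x y ->
  exists z1 z2, [/\ adj x z1, adj x z2, z1 != z2, z1 != y & z2 != y].
Proof.
rewrite is_leafE valenceE => v1 xy; have := not_2valent x; rewrite -/(valence x) valenceE => v2.
have v3 : (2 < #|[set y | adj x y]|)%N.
  have : (0 < #|[set y | adj x y]|)%N by apply/card_gt0P; exists y; rewrite inE.
  by move: v1 v2; case: #|_| => [|[|[]]].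
have := cardsD1 y [set y | adj x y]; rewrite inE xy => e.
have : (1 < #|[set y | adj x y] :\ y|)%N by lia.
case/card_gt1P => z1 [z2 []]; rewrite !inE => /andP[h1 h2] /andP[h3 h4] h5.
by exists z1, z2.
Qed.

(** Unless x is a leaf, another branch at x is a strictly smaller component with labels contained in
    this side, so induction on the size applies. *)
Lemma side_neq0 x y : adj x y -> side x y != set0.
Proof.
move: {2}(#|component x y|).+1 (ltnSn #|component x y|) => m.
elim: m x y => // m IHm x y le_m xy.
have [/codomP[i xi]|nl] := boolP (is_leaf x).
  by apply/set0Pn; exists i; rewrite in_side -xi comp_refl.
have [z [_ [xz _ _ zy _]]] := two_others nl xy.
have sub : component z x \subset component x y by apply: branch_subset; rewrite // eq_sym.
have /set0Pn[i iz] : side z x != set0.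
  apply: IHm; last by rewrite adjC.
  apply: leq_trans (_ : #|component x y| <= m)%N => //; apply: proper_card.
  apply/properP; split=> //; exists x; first exact: comp_refl.
  by apply: comp_notin; rewrite adjC.
by apply/set0Pn; exists i; rewrite in_side (subsetP sub) -?in_side.
Qed.



Lemma side_leaf x y i : is_leaf x -> adj x y -> x = leaf T i -> side x y = [set i].
Proof.
rewrite is_leafE valenceE => /cards1P[w ew] xy xi; apply/setP=> j; rewrite in_side in_set1.
apply/idP/eqP => [|->]; last by rewrite -xi comp_refl.
move=> jx; apply: (@leaf_inj _ T); rewrite -xi; apply/eqP.
have: leaf T j \in pred1 x; last by rewrite inE.
move: (leaf T j) jx; apply: comp_ind => [|a b _]; rewrite !inE // => /eqP-> xb.
have nb c : adj x c -> c = w.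
  by move=> xc; apply/set1P; rewrite -ew inE.
by rewrite (nb _ xb) (nb _ xy) eqxx.
Qed.

(** The inner vertex a has at least two branches besides that of b, and y lies in at most one of
    them. The labels of the other one belong to [side x y] but not to [side b a]. This is where the
    absence of 2-valent vertices makes different edges give different splits. *)
Lemma side_lt x y a b : adj x y -> adj a b -> ~~ is_leaf a ->
  (b \in component x y) && (y \notin component b a) -> (b, a) != (x, y) ->
  side b a \proper side x y.
Proof.
move=> xy ab nl /andP[bx yb] ne.
have ax : a \in component x y.
  apply: contraNT ne => ax; have ba : adj b a by rewrite adjC.
  by have [-> ->] := cross ba xy bx ax.
have sub := comp_subset bx yb.
have [z1 [z2 [az1 az2 z12 z1b z2b]]] := two_others nl ab.
have [z [az zb yz]] : exists z, [/\ adj a z, z != b & y \notin component z a].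
  have [y1|y1] := boolP (y \in component z1 a); last by exists z1.
  exists z2; split=> //; apply: contraNN z12 => y2; apply/eqP.
  exact: (branch_disjoint az1 az2 y1 y2).
have zx : z \in component x y.
  apply/negPn/negP => zx; have [_ zy] := cross az xy ax zx.
  by move: yz; rewrite zy comp_refl.
have /set0Pn[i iz] : side z a != set0 by apply: side_neq0; rewrite adjC.
have iz' : leaf T i \in component z a by rewrite -in_side.
apply/properP; split.
  by apply/subsetP=> j; rewrite !in_side; apply: (subsetP sub).
exists i; first by rewrite in_side (subsetP (comp_subset zx yz)).
rewrite in_side; apply: contraNN zb => ib; apply/eqP.
exact: (branch_disjoint az ab iz' ib).
Qed.

Lemma side_sub x y a b : (b \in component x y) && (y \notin component b a) ->
  side b a \subset side x y.
Proof.
case/andP=> h1 h2; apply/subsetP=> i; rewrite !in_side.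
exact: (subsetP (comp_subset h1 h2)).
Qed.

Lemma boundedE x y : bounded x y = [&& adj x y, ~~ is_leaf x & ~~ is_leaf y].
Proof. by rewrite !is_leafE. Qed.

Lemma side_inj x y a b : bounded x y -> bounded a b ->
  side x y = side a b -> (x, y) = (a, b).
Proof.
rewrite !boundedE => /and3P[xy lx ly] /and3P[ab la lb] e.
have ba : adj b a by rewrite adjC.
have yx : adj y x by rewrite adjC.
have eC : side y x = side b a by rewrite (sideC xy) (sideC ab) e.
have /set0Pn[i] := side_neq0 ab; have /set0Pn[j] := side_neq0 ba.
(* In the two parallel cases [side_lt] forbids equality of different edges; in the two opposite ones
   a nonempty side would be contained in its own complement. *)
case: (edges_nested xy ab) => h.
- move=> jb _; have := subsetP (side_sub h) j jb.
  by rewrite e -[_ \in _]negbK -in_setC -sideC // jb.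
- have [/eqP[-> ->]//|/(side_lt xy ba lb h)] := boolP ((a, b) == (x, y)).
  by rewrite e properxx.
- have [/eqP[-> ->]//|/(side_lt yx ab la h)] := boolP ((b, a) == (y, x)).
  by rewrite eC properxx.
- move=> _ ia; have := subsetP (side_sub h) i ia.
  by rewrite eC -[_ \in _]negbK -in_setC -sideC // ia.
Qed.

Lemma card_symm (P : rel (vert T)) : symmetric P -> irreflexive P ->
  #|[set e | P e.1 e.2]| = (#|[set [set e.1; e.2] | e in [set e | P e.1 e.2]]|).*2.
Proof.
move=> Ps Pi; rewrite -sum1_card (partition_big_imset (fun e => [set e.1; e.2])) /=.
rewrite -muln2 -sum_nat_const; apply: eq_bigr => s /imsetP[[x y]]; rewrite inE /= => xy ->.
rewrite sum1dep_card -(_ : #|[set (x, y); (y, x)]| = 2).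
  apply: eq_card => -[a b]; rewrite !inE /= eq_set2 !xpair_eqE.
  by apply/andP/idP => [[]//|/orP[]/andP[/eqP-> /eqP->]]; rewrite !eqxx /= ?orbT // Ps.
rewrite cards2 xpair_eqE (_ : x == y = false) //.
by apply: contraTF xy => /eqP->; rewrite Pi.
Qed.

Lemma bounded_sym : symmetric (@bounded n T).
Proof. by move=> x y; rewrite !boundedE adjC [X in _ && X]andbC. Qed.

Lemma bounded_irr : irreflexive (@bounded n T).
Proof. by move=> x; rewrite /bounded adj_irr. Qed.

Lemma nb_boundedE : #|[set e : vert T * vert T | bounded e.1 e.2]| = (nb_bounded T).*2.
Proof.
by rewrite (card_symm bounded_sym bounded_irr).
Qed.

Lemma card_splits : #|splits T| = (nb_bounded T).*2.
Proof.
rewrite -nb_boundedE -(card_in_imset (f := fun e => side e.1 e.2)).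
  apply: eq_card => s.
  by apply/imsetP/imsetP => -[e he ->]; exists e => //; move: he; rewrite !inE.
by move=> [x y] [a b]; rewrite !inE /=; apply: side_inj.
Qed.

Lemma splitsP I : reflect (exists x y, bounded x y /\ I = side x y) (I \in splits T).
Proof.
apply: (iffP imsetP) => [[[x y]]|[x [y [xy ->]]]]; first by rewrite inE /= => xy ->; exists x, y.
by exists (x, y); rewrite ?inE.
Qed.

Lemma splits_setC I : I \in splits T -> ~: I \in splits T.
Proof.
case/splitsP=> x [y [xy ->]]; apply/splitsP; exists y, x; rewrite bounded_sym xy.
by have /and3P[/sideC-> _ _] := xy.
Qed.

Lemma splits_compat I J : I \in splits T -> J \in splits T -> compat I J.
Proof.
case/splitsP=> x [y [/and3P[xy _ _] ->]] /splitsP[a [b [/and3P[ab _ _] ->]]].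
rewrite /compat -(sideC xy) -(sideC ab).
have ba : adj b a by rewrite adjC.
have yx : adj y x by rewrite adjC.
by case: (edges_nested ab xy) => /side_sub->; rewrite ?orbT.
Qed.

Lemma splits_card I : I \in splits T -> (1 < #|I|)%N.
Proof.
case/splitsP=> x [y []]; rewrite boundedE => /and3P[xy lx _] ->.
have [z [_ [xz _ _ zy _]]] := two_others lx xy.
have zx : adj z x by rewrite adjC.
have : side z x \proper side x y.
  apply: side_lt => //.
    rewrite (comp_step (comp_refl x y) xz) /=; last first.
      rewrite eq_set2 eqxx (negbTE zy) /=.
      by apply: contraTN xz => /andP[_ /eqP->]; rewrite adj_irr.
    apply: contraNN zy => yz; apply/eqP.
    exact: (branch_disjoint xz xy yz (comp_refl _ _)).
  rewrite xpair_eqE negb_and; apply/orP; left.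
  by apply: contraTN xz => /eqP->; rewrite adj_irr.
by move/proper_card; apply: leq_trans; rewrite ltnS card_gt0 side_neq0.
Qed.

(** * Counting vertices, edges and valences *)

Lemma card_relE (P : rel (vert T)) :
  #|[set e | P e.1 e.2]| = \sum_x #|[set y | P x y]|.
Proof.
rewrite -sum1dep_card (eq_bigl (fun e => true && P e.1 e.2)) //.
rewrite -(pair_big_dep xpredT P (fun _ _ => 1%N)) /=.
by apply: eq_bigr => x _; rewrite sum1dep_card.
Qed.

Lemma card_rel_swap (P : rel (vert T)) :
  #|[set e | P e.1 e.2]| = #|[set e | P e.2 e.1]|.
Proof.
have sK : involutive (fun e : vert T * vert T => (e.2, e.1)) by case.
rewrite -(card_imset _ (inv_inj sK)); apply: eq_card => -[x y].
rewrite inE /=; apply/imsetP/idP => [[[a b]]|xy]; first by rewrite inE => ? [-> ->].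
by exists (y, x); rewrite ?inE.
Qed.

Lemma card_relI (P Q : rel (vert T)) : #|[set e | P e.1 e.2]| =
  (#|[set e | P e.1 e.2 && Q e.1 e.2]| + #|[set e | P e.1 e.2 && ~~ Q e.1 e.2]|)%N.
Proof.
rewrite -(cardsID [set e | Q e.1 e.2]); congr addn; apply: eq_card => e; rewrite !inE //.
by rewrite andbC.
Qed.

(** Root the tree at r: every other vertex has exactly one neighbour in the direction of r. So there
    are as many edges as vertices other than r, and each edge gives two ordered pairs. *)
Lemma card_adj (r : vert T) : (#|[set e : vert T * vert T | adj e.1 e.2]| + 2 = #|vert T|.*2)%N.
Proof.
rewrite (card_relI _ (fun x y => r \in component y x)).
rewrite (card_rel_swap (fun x y => adj x y && (r \notin component y x))) /=.
have -> : #|[set e : vert T * vert T | adj e.2 e.1 && (r \notin component e.1 e.2)]| =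
    #|[set e : vert T * vert T | adj e.1 e.2 && (r \in component e.2 e.1)]|.
  apply: eq_card => -[x y]; rewrite [LHS]in_set [RHS]in_set /= adjC.
  by case xy: (adj x y) => //=; rewrite (compC xy) in_setC.
suff -> : #|[set e : vert T * vert T | adj e.1 e.2 && (r \in component e.2 e.1)]| = #|vert T|.-1.
  have : (0 < #|vert T|)%N by apply/card_gt0P; exists r.
  by move: #|vert T| => [|m] //= _; rewrite addn2 doubleS addnn.
rewrite (card_relE (fun x y => adj x y && (r \in component y x))).
rewrite (bigD1 r) //= (_ : #|_| = 0%N) ?add0n; last first.
  apply/eqP; rewrite cards_eq0; apply/eqP/setP => y; rewrite !inE.
  by apply/negP => /andP[ry]; rewrite (compC ry) inE comp_refl.
rewrite (eq_bigr (fun=> 1%N)) => [|x xr]; first by rewrite sum1_card (cardC1 r).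
have [y xy ry] := branch_exists xr; apply/eqP/cards1P; exists y.
apply/setP=> z; rewrite in_set in_set1; apply/andP/eqP => [[xz rz]|->//].
exact: branch_disjoint xz xy rz ry.
Qed.

Definition inner := [set x : vert T | ~~ is_leaf x].

Lemma card_vert : #|vert T| = (#|inner| + n)%N.
Proof.
rewrite -(cardsC inner); congr addn; rewrite -[RHS]card_ord -(card_codom (@leaf_inj _ T)).
by apply: eq_card => x; rewrite !inE negbK.
Qed.

Hypothesis n_gt2 : (2 < n)%N.

(** Two adjacent leaves would split the labels into two singletons, against n > 2. *)
Lemma leaf_nbr i : exists2 w, adj (leaf T i) w & ~~ is_leaf w.
Proof.
have li := is_leaf_leaf i; have := li; rewrite is_leafE valenceE => /cards1P[w ew].
have iw : adj (leaf T i) w by have := set11 w; rewrite -ew inE.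
exists w => //; apply/negP => lw; have /codomP[j wj] := lw.
have wi : adj w (leaf T i) by rewrite adjC.
have := cardsC (side w (leaf T i)); rewrite -(sideC wi) (side_leaf lw wi wj).
rewrite (side_leaf li iw (erefl _)) !cards1 card_ord; lia.
Qed.

Lemma card_leaf_edges :
  #|[set e : vert T * vert T | adj e.1 e.2 && is_leaf e.1]| = n.
Proof.
rewrite (card_relE (fun x y => adj x y && is_leaf x)).
rewrite (bigID is_leaf) /= [X in (_ + X)%N]big1 ?addn0 => [|x /negbTE nl]; last first.
  by apply/eqP; rewrite cards_eq0; apply/eqP/setP => y; rewrite !inE nl andbF.
rewrite (eq_bigr (fun=> 1%N)) => [|x lx].
  rewrite sum1_card -[RHS]card_ord -(card_codom (@leaf_inj _ T)).
  exact: eq_card.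
have /eqP <- : valence x == 1%N by rewrite -is_leafE.
by rewrite valenceE; apply: eq_card => y; rewrite !in_set lx andbT.
Qed.

(** Of the ordered edges n start at a leaf and n others end at one, since no two leaves are
    adjacent; the rest are the bounded edges, each in both directions. *)
Lemma card_inner : #|inner| = (nb_bounded T).+1.
Proof.
have k : 'I_n by exists 0%N; lia.
have := card_adj (leaf T k); rewrite card_vert.
rewrite (card_relI _ (fun x _ => is_leaf x)) card_leaf_edges.
rewrite (card_relI (fun x y => adj x y && ~~ is_leaf x) (fun _ y => is_leaf y)).
rewrite [X in (_ + (X + _) + _)%N](_ : _ = n); last first.
  rewrite (card_rel_swap (fun x y => adj x y && ~~ is_leaf x && is_leaf y)).
  rewrite -[RHS]card_leaf_edges; apply: eq_card => -[x y].
  rewrite !inE /= adjC -andbA; case xy: (adj x y) => //=.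
  case lx: (is_leaf x) => //=; rewrite ?andbF // andbT.
  have /codomP[i xi] := lx; have [w iw nw] := leaf_nbr i.
  suff -> : y = w by [].
  have := lx; rewrite is_leafE valenceE => /cards1P[v ev].
  have -> : y = v by apply/set1P; rewrite -ev inE.
  by apply/esym/set1P; rewrite -ev inE xi.
rewrite [X in (_ + (_ + X) + _)%N](_ : _ = (nb_bounded T).*2); first by lia.
rewrite -nb_boundedE; apply: eq_card => -[x y]; rewrite !inE /= boundedE.
by rewrite andbA.
Qed.

Lemma sum_valence : (\sum_(x in inner) valence x + 2 = #|inner|.*2 + n)%N.
Proof.
have k : 'I_n by exists 0%N; lia.
have := card_adj (leaf T k); rewrite card_vert.
rewrite (card_relI _ (fun x _ => is_leaf x)) card_leaf_edges.
rewrite (card_relE (fun x y => adj x y && ~~ is_leaf x)).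
rewrite (bigID (mem inner)) /= [X in (_ + (_ + X) + _)%N]big1 ?addn0.
  move=> e; rewrite (eq_bigr (fun x => #|[set y | adj x y && ~~ is_leaf x]|)); first by lia.
  move=> x; rewrite inE => nl; rewrite valenceE; apply: eq_card => y.
  by rewrite !inE nl andbT.
move=> x; rewrite inE negbK => lx; apply/eqP; rewrite cards_eq0; apply/eqP/setP => y.
by rewrite !inE lx andbF.
Qed.

Lemma inner_valence x : x \in inner -> (2 < valence x)%N.
Proof.
rewrite inE is_leafE => v1; have v2 := not_2valent x.
have : (0 < valence x)%N; last by move: v1 v2; rewrite -/(valence x); lia.
have k : 'I_n by exists 0%N; lia.
rewrite valenceE card_gt0; apply/set0Pn.
have : x != leaf T k by apply: contraNneq v1 => ->; rewrite -is_leafE is_leaf_leaf.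
by case/branch_exists=> y xy _; exists y; rewrite inE.
Qed.

Lemma valence4_exists : (nb_bounded T + 4 = n)%N ->
  exists2 x, valence x = 4 & forall y, ~~ is_leaf y -> y != x -> valence y = 3.
Proof.
move=> nb; have := sum_valence; have := card_inner => ci.
rewrite (eq_bigr (fun x => (valence x - 3) + 3)%N) => [|x /inner_valence]; last by lia.
rewrite big_split /= sum_nat_const => e.
(* With n - 3 inner vertices the valences add up to 3n - 8, one more than 3(n - 3). *)
have e1 : \sum_(x in inner) (valence x - 3) = 1%N by lia.
have [x /andP[xi vx]|no] := pickP [pred x in inner | valence x - 3 != 0]%N; last first.
  by move: e1; rewrite big1 // => x xi; have := no x; rewrite /= xi /= => /negbFE/eqP.
move: e1; rewrite (bigD1 x) //= => e1; exists x; first lia.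
move=> y yi yx; have := inner_valence (x := y); rewrite inE yi => /(_ isT).
have : \sum_(y in inner | y != x) (valence y - 3) = 0%N by lia.
rewrite (bigD1 y) /=; first lia.
by rewrite inE yi.
Qed.

(** * Splits that can be added to a tree *)

Lemma edge_uncut (J : {set 'I_n}) x y : (forall I, I \in splits T -> compat I J) -> adj x y ->
  [|| side x y \subset J, side x y \subset ~: J,
      side y x \subset J | side y x \subset ~: J].
Proof.
move=> cJ xy; have [/codomP[i xi]|lx] := boolP (is_leaf x).
  by rewrite xi (side_leaf (is_leaf_leaf i) _ (erefl _)) -?xi // !sub1set inE; case: (i \in J).
have [/codomP[i yi]|ly] := boolP (is_leaf y).
  rewrite yi [side _ x](side_leaf (is_leaf_leaf i) _ (erefl _)) -?yi 1?adjC //.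
  by rewrite !sub1set inE; case: (i \in J); rewrite ?orbT.
have /cJ : side x y \in splits T by apply/splitsP; exists x, y; rewrite boundedE xy lx ly.
by rewrite /compat -(sideC xy).
Qed.

Lemma branch_split x y : ~~ is_leaf x -> adj x y -> (1 < #|side y x|)%N -> side y x \in splits T.
Proof.
move=> lx xy c; apply/splitsP; exists y, x; rewrite boundedE lx adjC xy /=.
have [ly|//] := boolP (is_leaf y); have /codomP[i yi] := ly.
by move: c; rewrite (side_leaf ly _ yi) ?cards1 // adjC.
Qed.

(** J is a union of branches at x. A single branch with more than one label would be a split of the
    tree, so at least two branches are involved. *)
Lemma two_branches (J : {set 'I_n}) x : ~~ is_leaf x -> (1 < #|J|)%N -> J \notin splits T ->
  (forall y, adj x y -> (side y x \subset J) || (side y x \subset ~: J)) ->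
  exists y z, [/\ adj x y, adj x z, y != z, side y x \subset J & side z x \subset J].
Proof.
move=> lx cJ nJ unc.
have br i : i \in J -> exists y, [/\ adj x y, i \in side y x & side y x \subset J].
  move=> iJ; have : x != leaf T i by apply: contraNneq lx => ->; rewrite is_leaf_leaf.
  case/branch_exists=> y xy iy; exists y; split=> //; first by rewrite in_side.
  have := unc _ xy; case/orP => // /subsetP/(_ i); rewrite in_side iy inE iJ.
  by move/(_ isT).
have [i iJ] : exists i, i \in J by apply/card_gt0P; lia.
have [y [xy iy yJ]] := br i iJ.
have ne : side y x != J.
  by apply: contraNneq nJ => e; rewrite -e; apply: branch_split; rewrite // e.
have [j jJ jy] : exists2 j, j \in J & j \notin side y x.
  by apply/subsetPn; move: ne; rewrite eqEsubset yJ.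
have [z [xz jz zJ]] := br j jJ.
by exists y, z; split=> //; apply: contraNneq jy => ->.
Qed.

(* The vertex is found by minimizing the component of an edge side cut by J: by
   compatibility each edge has exactly one side that J cuts. *)
Lemma compat_vertex (J : {set 'I_n}) : (1 < #|J|)%N -> (1 < #|~: J|)%N -> J \notin splits T ->
  (forall I, I \in splits T -> compat I J) ->
  exists2 x, ~~ is_leaf x &
    forall y, adj x y -> (side y x \subset J) || (side y x \subset ~: J).
Proof.
move=> c1 c2 nJ cJ.
have nJ' : ~: J \notin splits T.
  by apply: contra nJ => /splits_setC; rewrite setCK.
pose unc (A : {set 'I_n}) := (A \subset J) || (A \subset ~: J).
have E1 x y : adj x y -> unc (side x y) || unc (side y x).
  by move=> /(edge_uncut cJ); rewrite /unc -orbA.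
have E0 x y : adj x y -> side x y != J.
  move=> xy; apply/negP => /eqP e; have yx : adj y x by rewrite adjC.
  have [ly|ly] := boolP (is_leaf y).
    have /codomP[i yi] := ly; have := side_leaf ly yx yi; rewrite (sideC xy) e => e2.
    by rewrite e2 cards1 in c2.
  by move: nJ; rewrite -e branch_split // e.
(* With both sides uncut, J would be empty, everything, or a side of the edge, and the last is
   excluded by [E0]. *)
have E2 x y : adj x y -> unc (side x y) -> ~~ unc (side y x).
  move=> xy u1; apply/negP => u2; have yx : adj y x by rewrite adjC.
  case/orP: u1 => u1; case/orP: u2; rewrite (sideC xy) ?setCS => u2.
  - have /card_gt0P[i] : (0 < #|~: J|)%N by lia.
    rewrite inE => /negP[]; have [/(subsetP u1)//|iy] := boolP (i \in side x y).
    by rewrite (subsetP u2) // inE.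
  - by have := E0 _ _ xy; rewrite eqEsubset u1 u2.
  - have := E0 _ _ yx; rewrite eqEsubset (sideC xy) u2 /=.
    by rewrite -setCS setCK u1.
  - have /card_gt0P[i iJ] : (0 < #|J|)%N by lia.
    by have := subsetP u1 i (subsetP u2 i iJ); rewrite inE iJ.
have k : 'I_n by exists 0%N; lia.
have [w kw _] := leaf_nbr k.
pose P := [pred e : vert T * vert T | adj e.1 e.2 && ~~ unc (side e.1 e.2)].
(* The opposite side is the single label k, hence uncut, so by [E2] this one is cut. *)
have Pw : P (w, leaf T k).
  rewrite /= adjC kw E2 // (side_leaf (is_leaf_leaf k) kw (erefl _)) //.
  by rewrite /unc !sub1set inE; case: (_ \in J).
case: (arg_minnP (fun e => #|component e.1 e.2|) Pw) => -[x y] /= /andP[xy cxy] min.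
have lx : ~~ is_leaf x.
  apply: contra cxy => lx; have /codomP[i xi] := lx.
  by rewrite (side_leaf lx xy xi) /unc !sub1set inE; case: (_ \in J).
exists x => // z xz; have zx : adj z x by rewrite adjC.
have [->|zy] := eqVneq z y; first by have := E1 _ _ xy; rewrite (negbTE cxy).
apply/negPn/negP => cz; have := min (z, x); rewrite /= zx cz => /(_ isT).
rewrite leqNgt => /negP[]; apply: proper_card; apply/properP; split.
  by apply: branch_subset; rewrite // eq_sym.
by exists x; [exact: comp_refl|exact: comp_notin].
Qed.

Definition addable (J : {set 'I_n}) :=
  [/\ (1 < #|J|)%N, (1 < #|~: J|)%N, J \notin splits T &
      forall I, I \in splits T -> compat I J].

Lemma branchP x i : ~~ is_leaf x -> exists2 y, adj x y & i \in side y x.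
Proof.
move=> lx; have /branch_exists[y xy iy] : x != leaf T i.
  by apply: contraNneq lx => ->; rewrite is_leaf_leaf.
by exists y; rewrite ?in_side.
Qed.

Lemma side_branch_disjoint x y z i : adj x y -> adj x z ->
  i \in side y x -> i \in side z x -> y = z.
Proof. by rewrite !in_side; apply: branch_disjoint. Qed.

(** The side of the edge that does not contain x is connected, so it lies in a single branch at
    x. *)
Lemma split_branch x I : I \in splits T ->
  exists2 y, adj x y & (I \subset side y x) || (~: I \subset side y x).
Proof.
case/splitsP=> a [b [/and3P[ab _ _] ->]].
have sub u v w : component u v \subset component w x -> side u v \subset side w x.
  by move/subsetP=> h; apply/subsetP=> i; rewrite !in_side => /h.
have [xa|xb] := boolP (x \in component a b).
  have : x \notin component b a by rewrite (compC ab) inE xa.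
  by case/edge_branch=> y xy /sub h; exists y; rewrite // -(sideC ab) h orbT.
by case/edge_branch: xb => y xy /sub h; exists y; rewrite // h.
Qed.

(** Since J and its complement each contain two branches, neither fits into one branch, so
    [split_branch] shows that J is no split of the tree. It also gives compatibility: a side of each
    split lies in one branch, which J does not cut. *)
Lemma branches_addable (J : {set 'I_n}) x y1 y2 z1 z2 :
  [/\ adj x y1, adj x y2, adj x z1 & adj x z2] -> y1 != y2 -> z1 != z2 ->
  side y1 x :|: side y2 x \subset J -> side z1 x :|: side z2 x \subset ~: J ->
  (forall y, adj x y -> (side y x \subset J) || (side y x \subset ~: J)) ->
  addable J.
Proof.
case=> xy1 xy2 xz1 xz2 ny nz yJ zJ unc.
have two (K : {set 'I_n}) u v : adj x u -> adj x v -> u != v -> side u x :|: side v x \subset K ->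
  (1 < #|K|)%N /\ forall w, adj x w -> ~~ (K \subset side w x).
  move=> xu xv uv; rewrite subUset => /andP[/subsetP uK /subsetP vK].
  have /set0Pn[i iu] : side u x != set0 by apply: side_neq0; rewrite adjC.
  have /set0Pn[j jv] : side v x != set0 by apply: side_neq0; rewrite adjC.
  split=> [|w xw].
    apply/card_gt1P; exists i, j; split; [exact: uK|exact: vK|].
    apply: contraNneq uv => ij; apply/eqP; apply: side_branch_disjoint xu xv iu _.
    by rewrite ij.
  apply: contraNN uv => /subsetP Kw; apply/eqP.
  rewrite (side_branch_disjoint xu xw iu (Kw _ (uK _ iu))).
  by rewrite (side_branch_disjoint xv xw jv (Kw _ (vK _ jv))).
have [J1 J2] := two _ _ _ xy1 xy2 ny yJ; have [K1 K2] := two _ _ _ xz1 xz2 nz zJ.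
split=> // [|I /(split_branch x)[y xy Iy]].
  apply/negP => /(split_branch x)[w xw /orP[]]; first by rewrite (negbTE (J2 _ xw)).
  by rewrite (negbTE (K2 _ xw)).
by rewrite /compat; case/orP: (unc _ xy) => yK; case/orP: Iy => /subset_trans/(_ yK)->;
  rewrite ?orbT.
Qed.

(** A, B, C, D are the label sets of the branches at the 4-valent vertex, D being that of k. The
    last clause holds because D is a singleton exactly if its branch is a leaf, necessarily the leaf
    k. *)
Lemma codim1_star k : (nb_bounded T + 4 = n)%N ->
  exists A B C : {set 'I_n}, let D := ~: (A :|: B :|: C) in
  [/\ [/\ [disjoint A & B], [disjoint A & C], [disjoint B & C] & k \in D],
      forall U, U \in [:: A; B; C; D] -> U \in splits T \/ #|U| = 1%N,
      [/\ A :|: B != A :|: C, A :|: B != B :|: C & A :|: C != B :|: C],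
      forall J : {set 'I_n}, k \notin J -> addable J <-> J \in [:: A :|: B; A :|: C; B :|: C] &
      #|D| = 1%N <-> exists2 x, adj (leaf T k) x & valence x = 4].
Proof.
case/valence4_exists=> x v4 v3.
have lx : ~~ is_leaf x by rewrite is_leafE v4.
have [y4 xy4 k4] := branchP k lx.
have [y1 [y2 [y3 [[N1 N2 N3] [y12 y23 y31]]]]] :
  exists y1 y2 y3, [/\ y1 \in [set y | adj x y] :\ y4, y2 \in [set y | adj x y] :\ y4 &
     y3 \in [set y | adj x y] :\ y4] /\ [/\ y1 != y2, y2 != y3 & y3 != y1].
  apply/card_gt2P; have := cardsD1 y4 [set y | adj x y].
  by rewrite -valenceE v4 inE xy4; case: #|_| => [|[|[|]]].
move: N1 N2 N3; rewrite !in_setD1 !in_set => /andP[y14 xy1] /andP[y24 xy2] /andP[y34 xy3].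
have nbr y : adj x y -> y \in [:: y1; y2; y3; y4].
  move=> xy; have : y1 |: (y2 |: (y3 |: [set y4])) = [set y | adj x y].
    apply/eqP; rewrite eqEcard; apply/andP; split.
      by apply/subsetP=> z; rewrite !inE => /or4P[]/eqP->.
    by rewrite -valenceE v4 !cardsU1 cards1 !inE !negb_or y12 y23 [y1 == y3]eq_sym y31 y14 y24 y34.
  by move/setP/(_ y); rewrite !inE xy.
have dis y z : adj x y -> adj x z -> y != z -> [disjoint side y x & side z x].
  move=> xy xz yz; apply/pred0P => i /=; apply: contraNF yz => /andP[iy iz].
  exact/eqP/(side_branch_disjoint xy xz iy iz).
have sne y : adj x y -> side y x != set0 by move=> xy; apply: side_neq0; rewrite adjC.
have y13 : y1 != y3 by rewrite eq_sym.
have d12 := dis _ _ xy1 xy2 y12; have d13 := dis _ _ xy1 xy3 y13.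
have d23 := dis _ _ xy2 xy3 y23; have d14 := dis _ _ xy1 xy4 y14.
have d24 := dis _ _ xy2 xy4 y24; have d34 := dis _ _ xy3 xy4 y34.
have DE : side y4 x = ~: (side y1 x :|: side y2 x :|: side y3 x).
  apply/setP=> i; have [y xy iy] := branchP i lx.
  have h z : adj x z -> (i \in side z x) = (z == y).
    move=> xz; apply/idP/eqP => [iz|->//]; exact: side_branch_disjoint xz xy iz iy.
  rewrite in_setC !in_setU !h //.
  by move: (nbr _ xy); rewrite !inE => /or4P[]/eqP->;
    rewrite ?eqxx ?(negbTE y12) ?(negbTE y14) ?(negbTE y23) ?(negbTE y24) ?(negbTE y34)
      ?(negbTE y13) ?orbT // ![y4 == _]eq_sym ?(negbTE y14) ?(negbTE y24) ?(negbTE y34).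
exists (side y1 x), (side y2 x), (side y3 x); rewrite /= -DE; split.
- by split.
- move=> U; rewrite !inE => hU.
  have [y xy ->] : exists2 y, adj x y & U = side y x.
    by case/or4P: hU => /eqP->; [exists y1|exists y2|exists y3|exists y4].
  have [c|c] := ltnP 1 #|side y x|; first by left; apply: branch_split.
  by right; apply/eqP; rewrite eqn_leq c card_gt0 sne.
- have neq (P Q S X : {set 'I_n}) : P != set0 -> [disjoint P & Q] -> [disjoint P & S] ->
     P \subset X -> X != Q :|: S.
    case/set0Pn=> i iP PQ PS /subsetP/(_ i iP) iX; apply: contraTneq iX => ->.
    by rewrite inE (disjointFr PQ iP) (disjointFr PS iP).
  split; [apply: (neq (side y2 x))|apply: (neq (side y1 x))|apply: (neq (side y1 x))];
    by rewrite ?sne ?subsetUl ?subsetUr // disjoint_sym.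
- move=> J kJ; split=> [[c1 c2 nJ cJ]|]; last first.
    have add u v w : adj x u -> adj x v -> adj x w -> u != v -> u != w -> v != w ->
        u != y4 -> v != y4 -> w != y4 -> (forall y, adj x y -> y \in [:: u; v; w; y4]) ->
        addable (side u x :|: side v x).
      move=> xu xv xw uv uw vw u4 v4' w4 cov.
      have out z : adj x z -> u != z -> v != z -> side z x \subset ~: (side u x :|: side v x).
        move=> xz uz vz; rewrite setCU subsetI -!disjoints_subset.
        by rewrite !dis // eq_sym.
      apply: (@branches_addable _ x u v w y4) => //; first by rewrite subUset !out.
      move=> y xy; have := cov y xy; rewrite !inE => /or4P[]/eqP->.
      + by rewrite subsetUl.
      + by rewrite subsetUr.
      + by rewrite out ?orbT.
      + by rewrite out ?orbT.
    rewrite !inE => /or3P[]/eqP->.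
    + exact: (add y1 y2 y3).
    + apply: (add y1 y3 y2) => // [|y /nbr]; first by rewrite eq_sym.
      by rewrite !inE => /or4P[]->; rewrite ?orbT.
    + apply: (add y2 y3 y1) => // [|y /nbr]; first by rewrite eq_sym.
      by rewrite !inE => /or4P[]->; rewrite ?orbT.
  have [x' lx' unc] := compat_vertex c1 c2 nJ cJ.
  have [u [v [xu xv uv uJ vJ]]] := two_branches lx' c1 nJ unc.
  have nJ' : ~: J \notin splits T by apply: contra nJ => /splits_setC; rewrite setCK.
  have unc' y : adj x' y -> (side y x' \subset ~: J) || (side y x' \subset ~: ~: J).
    by move/unc; rewrite setCK orbC.
  have [w [z [xw xz wz wJ zJ]]] := two_branches lx' c2 nJ' unc'.
  have ne y y' : adj x' y -> side y x' \subset J -> side y' x' \subset ~: J -> y != y'.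
    move=> xy yJ; apply: contraTneq => <-.
    have /set0Pn[i iy] : side y x' != set0 by apply: side_neq0; rewrite adjC.
    by apply/subsetPn; exists i; rewrite // inE negbK (subsetP yJ).
  (* Two branches inside J and two outside are four distinct neighbours, too many for a 3-valent
     vertex. *)
  have x'x : x' = x.
    apply/eqP/negPn/negP => /(v3 _ lx'); rewrite valenceE => v3'.
    have : [set u; v; w; z] \subset [set y | adj x' y].
      by apply/subsetP => y; rewrite !inE -!orbA => /or4P[]/eqP->.
    move/subset_leq_card; rewrite v3' -!setUA !cardsU1 cards1 !inE !negb_or.
    by rewrite uv wz !ne.
  rewrite {x'}x'x in lx' unc unc' xu xv uJ vJ xw xz wJ zJ ne *.
  (* J is determined by the branches it contains: not that of k, at least two of the other three by
     u and v, and not all three by w and z. *)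
  pose p y := side y x \subset J.
  have np y : adj x y -> side y x \subset ~: J -> p y = false.
    by move=> xy yJ; apply/negP => /ne-/(_ _ xy yJ); rewrite eqxx.
  have p4 : p y4 = false.
    by apply/negP => /subsetP/(_ _ k4); rewrite (negbTE kJ).
  have inJ y i : adj x y -> i \in side y x -> (i \in J) = p y.
    move=> xy iy; case/orP: (unc _ xy) => yJ; first by rewrite /p yJ (subsetP yJ).
    by rewrite np //; apply/negbTE; have := subsetP yJ i iy; rewrite inE.
  have JE (K : {set 'I_n}) :
    (forall y, adj x y -> side y x \subset if p y then K else ~: K) -> J = K.
    move=> h; apply/setP=> i; have [y xy iy] := branchP i lx.
    rewrite (inJ y) //; have := subsetP (h y xy) i iy.
    by case: (p y) => [->//|]; rewrite inE => /negbTE.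
  have p2 : [|| p y1 && p y2, p y1 && p y3 | p y2 && p y3].
    move: (nbr _ xu) (nbr _ xv) uv (uJ) (vJ); rewrite -/(p u) -/(p v) !inE.
    by move=> /or4P[]/eqP-> /or4P[]/eqP->; rewrite ?eqxx ?p4 // => _ -> ->; rewrite ?orbT.
  have p3 : ~~ [&& p y1, p y2 & p y3].
    move: (nbr _ xw) (nbr _ xz) wz (np _ xw wJ) (np _ xz zJ); rewrite !inE.
    by move=> /or4P[]/eqP-> /or4P[]/eqP->; rewrite ?eqxx // => _ h1 h2; rewrite ?h1 ?h2 ?andbF.
  rewrite !inE; have {}JE u' v' w' : p u' -> p v' -> ~~ p w' ->
      adj x u' -> adj x v' -> adj x w' -> u' != w' -> v' != w' ->
      (forall y, adj x y -> y \in [:: u'; v'; w'; y4]) -> u' != y4 -> v' != y4 ->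
      J = side u' x :|: side v' x.
    move=> pu pv pw xu' xv' xw' uw vw cov u4 v4'; apply: JE => y xy.
    have := cov _ xy; rewrite !inE => /or4P[]/eqP->; rewrite ?pu ?pv ?(negbTE pw) ?p4.
    + exact: subsetUl.
    + exact: subsetUr.
    + by rewrite setCU subsetI -!disjoints_subset !dis // eq_sym.
    + by rewrite setCU subsetI -!disjoints_subset !dis // eq_sym.
  case/or3P: p2 => /andP[pa pb]; move: p3; rewrite pa pb /= ?andbT => pc.
  + by rewrite (JE y1 y2 y3) ?eqxx.
  + rewrite (JE y1 y3 y2) ?eqxx ?orbT // => [|y /nbr]; first by rewrite eq_sym.
    by rewrite !inE => /or4P[]->; rewrite ?orbT.
  + rewrite (JE y2 y3 y1) ?eqxx ?orbT // => [|y /nbr]; first by rewrite eq_sym.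
    by rewrite !inE => /or4P[]->; rewrite ?orbT.
- split=> [c|[w kw w4]].
    have [l4|l4] := boolP (is_leaf y4); last first.
      have : side y4 x \in splits T.
        by apply/splitsP; exists y4, x; rewrite boundedE adjC xy4 lx l4.
      by move/splits_card; rewrite c.
    exists x => //; have /codomP[i yi] := l4.
    have y4x : adj y4 x by rewrite adjC.
    by move: k4; rewrite (side_leaf l4 y4x yi) inE => /eqP ->; rewrite -yi.
  have wx : w = x.
    have lw : ~~ is_leaf w by rewrite is_leafE w4.
    by apply: contraTeq isT => wx; have := v3 w lw wx; rewrite w4.
  have xk : adj x (leaf T k) by rewrite adjC -wx.
  have <- : leaf T k = y4.
    by apply: side_branch_disjoint xk xy4 _ k4; rewrite in_side comp_refl.
  by rewrite (side_leaf (is_leaf_leaf k) _ (erefl _)) ?cards1 // adjC.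
Qed.

(** The pair provides the zero coefficient of the positive representations on the cone of T. The
    labels i and j are taken from two branches other than k at the neighbour w of the leaf k. A side
    without k that contained both would not fit into one branch at w, so its complement would; that
    branch would be the leaf k, which has too few labels. *)
Lemma separated_pair k : exists i j, [/\ i != j, i != k, j != k &
  forall I, I \in splits T -> k \notin I -> ~~ ((i \in I) && (j \in I))].
Proof.
have [w kw lw] := leaf_nbr k; have wk : adj w (leaf T k) by rewrite adjC.
have [y [z [wy wz yz yk zk]]] := two_others lw wk.
have kk : k \in side (leaf T k) w by rewrite in_side comp_refl.
have /set0Pn[i iy] : side y w != set0 by apply: side_neq0; rewrite adjC.
have /set0Pn[j jz] : side z w != set0 by apply: side_neq0; rewrite adjC.
have ne u v (a b : 'I_n) :
  adj w u -> adj w v -> u != v -> a \in side u w -> b \in side v w -> a != b.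
  move=> wu wv uv au bv; apply: contraNneq uv => ab; apply/eqP.
  by apply: side_branch_disjoint wu wv au _; rewrite ab.
exists i, j; split; [exact: (ne y z)|exact: (ne y (leaf T k))|exact: (ne z (leaf T k))|].
move=> I sI kI; apply/negP => /andP[iI jI].
have [u wu /orP[/subsetP h|h]] := split_branch w sI.
  have yu := side_branch_disjoint wy wu iy (h _ iI).
  by move: yz; rewrite yu (side_branch_disjoint wz wu jz (h _ jI)) eqxx.
have uk : u = leaf T k.
  by apply: side_branch_disjoint wu wk _ kk; apply: (subsetP h); rewrite inE.
have := splits_card (splits_setC sI); have := subset_leq_card h.
by rewrite uk (side_leaf (is_leaf_leaf k) kw (erefl _)) cards1 => h1 /leq_trans/(_ h1).
Qed.

End TreeTheory.

Lemma card_eq1 (U : finType) (P : pred U) (x : U) :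
  (forall y, P y = (y == x)) -> #|P| = 1%N.
Proof. by move=> h; rewrite (eq_card h) card1. Qed.

(** * The tree of a compatible split system *)

Section Buneman.
Variables (n : nat) (k : 'I_n) (F : {set {set 'I_n}}).
Hypothesis n_gt2 : (2 < n)%N.
Hypothesis F_setC : forall I, I \in F -> ~: I \in F.
Hypothesis F_card : forall I, I \in F -> (1 < #|I|)%N.
Hypothesis F_compat : forall I J, I \in F -> J \in F -> compat I J.

(* Rooting a tree at the leaf k, a vertex is determined by the labels below it:
   {i} at the leaf i, and by convention setT at the leaf k itself. *)
Definition clusters : {set {set 'I_n}} :=
  [set A in F | k \notin A] :|: [set [set i] | i in [set~ k]] :|: [set [set~ k]; setT].

Lemma clustersP A : reflect
  [\/ A \in F /\ k \notin A, exists2 i, i != k & A = [set i], A = [set~ k] | A = setT]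
  (A \in clusters).
Proof.
rewrite !inE -!orbA; apply: (iffP or4P) => -[].
- by case/andP; constructor 1.
- by case/imsetP => i; rewrite !inE => ik ->; constructor 2; exists i.
- by move/eqP; constructor 3.
- by move/eqP; constructor 4.
- by case=> -> ->; constructor 1.
- by case=> i ik ->; constructor 2; apply/imsetP; exists i; rewrite ?inE.
- by move=> ->; constructor 3.
- by move=> ->; constructor 4.
Qed.

Lemma cluster_setT : setT \in clusters.
Proof. by apply/clustersP; constructor 4. Qed.

Lemma cluster_neq0 A : A \in clusters -> A != set0.
Proof.
case/clustersP=> [[/F_card c _]|[i _ ->]|->|->]; rewrite -card_gt0 ?cards1 //.
- by lia.
- by rewrite cardsC1 card_ord; lia.
- by rewrite cardsT card_ord; lia.
Qed.

Lemma cluster_sub A : A \in clusters -> A != setT -> A \subset [set~ k].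
Proof.
case/clustersP=> [[_ kA]|[i ik ->]|->|->]; rewrite ?eqxx // => _.
- by rewrite subsetC sub1set inE.
- by rewrite subsetC sub1set !inE eq_sym.
Qed.

(** Omitting k from both sets turns compatibility into nesting or disjointness: the fourth case, in
    which the complement of A lies in B, would put k into B. *)
Lemma laminar A B : A \in clusters -> B \in clusters ->
  [|| A \subset B, B \subset A | [disjoint A & B]].
Proof.
move=> cA cB; have [->|AT] := eqVneq A setT; first by rewrite subsetT orbT.
have [->|BT] := eqVneq B setT; first by rewrite subsetT.
have sA := cluster_sub cA AT; have sB := cluster_sub cB BT.
case/clustersP: (cA) sB => [[FA kA]|[i ik ->]|->|eA] sB; last by rewrite eA eqxx in AT.
- case/clustersP: (cB) sA => [[FB kB]|[i ik ->]|->|eB] sA; last by rewrite eB eqxx in BT.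
  + case/or4P: (F_compat FA FB) => h; rewrite ?h ?orbT //.
    * by rewrite disjoints_subset h !orbT.
    * by have /subsetP/(_ k) := h; rewrite inE kA (negbTE kB) => /(_ isT).
    * by have := h; rewrite setCS => ->; rewrite orbT.
  + have [iA|iA] := boolP (i \in A); first by rewrite [_ \subset A]sub1set iA orbT.
    by rewrite disjoint_sym disjoints1 iA !orbT.
  + by rewrite sA.
- have [iB|iB] := boolP (i \in B); first by rewrite [_ \subset B]sub1set iB.
  by rewrite disjoints1 iB !orbT.
- by rewrite sB orbT.
Qed.

Local Notation V := {A : {set 'I_n} | A \in clusters}.
Implicit Types A B C : V.

(** B is the parent of A in the tree rooted at the leaf k. *)
Definition covers A B :=
  (val A \proper val B) && [forall C : V, ~~ ((val A \proper val C) && (val C \proper val B))].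

(** A is nonempty, which rules out the disjoint case of [laminar]; parents are therefore unique. *)
Lemma chain A B C : val A \subset val B -> val A \subset val C ->
  (val B \subset val C) || (val C \subset val B).
Proof.
move=> AB sAC; case/or3P: (laminar (valP B) (valP C)) => [->//|->|]; first by rewrite orbT.
have /set0Pn[i iA] := cluster_neq0 (valP A).
by move/pred0P/(_ i); rewrite /= (subsetP AB) ?(subsetP sAC).
Qed.

Lemma cover_le A B C : covers A B -> val A \proper val C -> val B \subset val C.
Proof.
case/andP=> AB /forallP/(_ C); rewrite negb_and => h sAC; move: h; rewrite sAC /=.
case/orP: (chain (proper_sub AB) (proper_sub sAC)) => // CB.
by rewrite properE CB /= negbK.
Qed.

Lemma cover_inj A B C : covers A B -> covers A C -> B = C.
Proof.
move=> AB sAC; apply/val_inj/eqP; rewrite eqEsubset.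
by rewrite (cover_le AB) ?(cover_le sAC) //; [case/andP: AB|case/andP: sAC].
Qed.

Lemma cover_up A B : val A \proper val B -> exists2 C, covers A C & val C \subset val B.
Proof.
move=> AB; have P0 : [pred C : V | val A \proper val C] B by [].
case: (arg_minnP (fun C : V => #|val C|) P0) => C /= sAC min; exists C.
  rewrite /covers sAC; apply/forallP => D; apply/negP => /andP[AD /proper_card].
  by rewrite ltnNge min.
have sAC' : covers A C.
  rewrite /covers sAC; apply/forallP => D; apply/negP => /andP[AD /proper_card].
  by rewrite ltnNge min.
exact: cover_le sAC' AB.
Qed.

Lemma cover_down A B : val A \proper val B -> exists2 C, covers C B & val A \subset val C.
Proof.
move=> AB; have P0 : [pred C : V | (val A \subset val C) && (val C \proper val B)] A.
  by rewrite /= subxx.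
case: (arg_maxnP (fun C : V => #|val C|) P0) => C /= /andP[sAC CB] max; exists C => //.
rewrite /covers CB; apply/forallP => D; apply/negP => /andP[CD DB].
have := max D; rewrite /= DB (subset_trans sAC (proper_sub CD)) => /(_ isT).
by rewrite leqNgt proper_card.
Qed.

Definition cover_adj A B := covers A B || covers B A.

Lemma cover_adj_sym : symmetric cover_adj.
Proof. by move=> A B; rewrite /cover_adj orbC. Qed.

Lemma cover_irr A : covers A A = false.
Proof. by rewrite /covers properxx. Qed.

Lemma cover_adj_irr : irreflexive cover_adj.
Proof. by move=> A; rewrite /cover_adj cover_irr. Qed.

Definition top : V := exist _ setT cluster_setT.

Lemma connect_top A : connect cover_adj A top.
Proof.
move: {2}#|~: val A|.+1 (ltnSn #|~: val A|) => m; elim: m A => // m IHm A lt_m.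
have [e|AT] := eqVneq A top; first by rewrite e.
have : val A \proper val top.
  by rewrite properT; apply: contraNneq AT => e; apply/eqP/val_inj.
case/cover_up=> C sAC _; apply: connect_trans (connect1 _) (IHm C _).
  by rewrite /cover_adj sAC.
have /andP[pr _] := sAC; apply: (@leq_trans #|~: val A|) => //; apply: proper_card.
by rewrite properC.
Qed.

Lemma cover_adj_connected A B : connect cover_adj A B.
Proof.
apply: connect_trans (connect_top A) _; rewrite sym_connect_sym ?connect_top //.
exact: cover_adj_sym.
Qed.

(* A smallest cluster of a cycle is covered by both of its neighbours. *)
Lemma cover_adj_acyclic (p : seq V) : ucycle cover_adj p -> (size p <= 2)%N.
Proof.
case/andP=> cyc up; rewrite leqNgt; apply/negP => sz.
have [A0 A0p] : exists A, A \in p by case: (p) sz => // A q _; exists A; rewrite mem_head.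
case: (arg_minnP (fun C : V => #|val C|) (P := mem p) A0p) => A Ap min.
have small B : B \in p -> cover_adj A B -> covers A B.
  move=> Bp; case/orP=> // /andP[/proper_card BA _].
  by have := min B Bp; rewrite leqNgt BA.
have [i [|B [|C q]] pE] := rot_to Ap; have := size_rot i p; rewrite pE => sp;
  try by rewrite -sp in sz.
have := rot_cycle i cover_adj p; rewrite pE cyc.
have := rot_uniq i p; rewrite pE up.
rewrite (cycle_path A) /= => /and3P[_ nB _] /and4P[LA AB _ _].
have Bp : B \in p by rewrite -(mem_rot i) pE !inE eqxx orbT.
have Lp : last C q \in p by rewrite -(mem_rot i) pE 2!inE mem_last !orbT.
rewrite cover_adj_sym in LA.
have e := cover_inj (small _ Bp AB) (small _ Lp LA).
by move: nB; rewrite e mem_last.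
Qed.

(** The default [top] is never taken, since the set chosen is always a cluster. *)
Definition cluster_leaf (i : 'I_n) : V :=
  odflt top (insub (if i == k then setT else [set i])).

Lemma val_cluster_leaf i : val (cluster_leaf i) = if i == k then setT else [set i].
Proof.
rewrite /cluster_leaf insubT /=; first case: eqVneq => ik.
- by apply/clustersP; constructor 4.
- by apply/clustersP; constructor 2; exists i.
- by [].
Qed.

Lemma setT_neq1 (i : 'I_n) : setT != [set i].
Proof.
apply/eqP => /(congr1 (fun A : {set _} => #|A|)); rewrite cardsT card_ord cards1 => h.
by have := n_gt2; rewrite h.
Qed.

Lemma cluster_leaf_inj : injective cluster_leaf.
Proof.
move=> i j /(congr1 val); rewrite !val_cluster_leaf.
case: eqVneq => [->|ik]; case: eqVneq => [->|jk] //.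
- by move/eqP; rewrite (negbTE (setT_neq1 _)).
- by move/esym/eqP; rewrite (negbTE (setT_neq1 _)).
- exact: set1_inj.
Qed.

(** The complement of k is the largest cluster below [setT]. It is the inner vertex next to the leaf
    k, and gives that leaf valence one. *)
Lemma cover_adj_top A : cover_adj top A = (val A == [set~ k]).
Proof.
have cX : [set~ k] \in clusters by apply/clustersP; constructor 3.
pose X : V := exist _ [set~ k] cX.
have XT : val X \proper val top.
  by rewrite properT; apply/eqP => /setP/(_ k); rewrite !inE eqxx.
have subX C : val C \proper setT -> val C \subset val X.
  by rewrite properT; apply: cluster_sub; apply: valP.
apply/orP/eqP => [[/andP[/properP[_ [i]]]|sAT]|e].
- by rewrite inE.
- apply: (congr1 val (_ : A = X)); apply/val_inj/eqP; rewrite eqEsubset.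
  have /andP[AT _] := sAT; rewrite subX //=; apply/negPn/negP => XA.
  have /andP[_ /forallP/(_ X)] := sAT; rewrite XT properE XA.
  by rewrite subX.
- have -> : A = X by apply: val_inj.
  right; rewrite /covers XT; apply/forallP => C; apply/negP => /andP[XC CT].
  by have := subX _ CT; rewrite (negbTE (proper_subn XC)).
Qed.

Lemma covers_top A : covers A top = (val A == [set~ k]).
Proof.
rewrite -cover_adj_top /cover_adj [covers top A](_ : _ = false) //.
by apply/negP => /andP[/properP[_ [i _]]]; rewrite inE.
Qed.

Lemma card_cover_adj_top : #|cover_adj top| = 1%N.
Proof.
have cX : [set~ k] \in clusters by apply/clustersP; constructor 3.
apply: (@card_eq1 _ _ (exist _ [set~ k] cX)) => A; rewrite cover_adj_top.
apply/eqP/eqP => [e|->//]; exact: val_inj.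
Qed.

Lemma card_cover_adj_set1 A i : i != k -> val A = [set i] -> #|cover_adj A| = 1%N.
Proof.
move=> ik Ai; have : val A \proper val top by rewrite Ai properT eq_sym setT_neq1.
case/cover_up=> C sAC _; apply: (@card_eq1 _ _ C) => B.
apply/orP/eqP => [[AB|/andP[pBA _]]|->]; [exact: cover_inj AB sAC| |by left].
move: pBA; rewrite Ai properE sub1set subset1 => /andP[/orP[/eqP->|/eqP B0]].
  by rewrite set11.
by have := cluster_neq0 (valP B); rewrite B0 eqxx.
Qed.

Lemma cluster_leafP A :
  reflect (val A = setT \/ exists2 i, i != k & val A = [set i]) (A \in codom cluster_leaf).
Proof.
apply: (iffP codomP) => [[i ->]|[AT|[i ik Ai]]].
- by rewrite val_cluster_leaf; case: (eqVneq i k) => ik; [left|right; exists i].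
- by exists k; apply: val_inj; rewrite val_cluster_leaf eqxx.
- by exists i; apply: val_inj; rewrite val_cluster_leaf (negbTE ik).
Qed.

(** Besides its parent A has at least two children: the children cover all labels of A because the
    singletons are clusters, and no single child exhausts A. *)
Lemma card_cover_adj_inner A : A \notin codom cluster_leaf -> (2 < #|cover_adj A|)%N.
Proof.
move=> /cluster_leafP nl; have AT : val A != setT by apply/eqP => ?; apply: nl; left.
have n1 i : i != k -> val A != [set i] by move=> ik; apply/eqP => ?; apply: nl; right; exists i.
have [P AP _] : exists2 P, covers A P & val P \subset val top by apply: cover_up; rewrite properT.
have child i : i \in val A -> exists2 C, covers C A & i \in val C.
  move=> iA; have ik : i != k.
    by have /subsetP/(_ i iA) := cluster_sub (valP A) AT; rewrite !inE.
  have vi : val (cluster_leaf i) = [set i] by rewrite val_cluster_leaf (negbTE ik).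
  have : val (cluster_leaf i) \proper val A.
    by rewrite vi properEneq eq_sym n1 //= sub1set.
  by case/cover_down=> C sCA; rewrite vi sub1set; exists C.
have /set0Pn[i iA] := cluster_neq0 (valP A); have [C CA iC] := child i iA.
have /andP[/properP[_ [j jA jC]] _] := CA; have [D DA jD] := child j jA.
apply/card_gt2P; exists P, C, D; rewrite /in_mem /= /cover_adj AP CA DA !orbT; split=> //.
have asym B B' : covers B B' -> covers B' B = false.
  by case/andP=> /proper_sub h _; apply/negP => /andP[]; rewrite properE h andbF.
split; first by apply: contraTneq AP => ->; rewrite asym.
  by apply: contraNneq jC => ->.
by apply: contraTneq AP => <-; rewrite asym.
Qed.

Lemma cluster_leaf1 A : (A \in codom cluster_leaf) = (#|cover_adj A| == 1%N).
Proof.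
apply/idP/eqP => [/cluster_leafP[AT|[i ik Ai]]|c1].
- by rewrite (_ : A = top) ?card_cover_adj_top //; apply: val_inj.
- exact: card_cover_adj_set1 ik Ai.
- by apply/negPn/negP => /card_cover_adj_inner; rewrite c1.
Qed.

Lemma card_cover_adj_neq2 A : #|cover_adj A| != 2%N.
Proof.
have [|/card_cover_adj_inner] := boolP (A \in codom cluster_leaf).
  by rewrite cluster_leaf1 => /eqP->.
by case: #|_| => [|[|[]]].
Qed.

Definition cluster_tree : tree n :=
  Tree cover_adj_sym cover_adj_irr cover_adj_connected cover_adj_acyclic
    cluster_leaf_inj cluster_leaf1 card_cover_adj_neq2.

(** The edge from A to its parent is the only one leaving the clusters contained in A, so these are
    the vertices on the side of A. Among the leaves they are the singletons of the labels of A; the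
    leaf k is [setT] and lies above. *)
Lemma cluster_side A B : covers A B -> @side n cluster_tree A B = val A.
Proof.
move=> AB; have aAB : @adj n cluster_tree A B by rewrite /= /cover_adj AB.
have low : {subset @component n cluster_tree A B <= [pred C : V | val C \subset val A]}.
  apply: comp_ind => [|a b _]; rewrite !inE // => aA /orP[ab|/andP[/proper_sub ba _]] ne.
    have [e|aA'] := eqVneq (val a) (val A).
      have {e}e : a = A by apply: val_inj.
      by move: ne; rewrite e (cover_inj (etrans (congr1 (covers^~ b) (esym e)) ab) AB) eqxx.
    by apply: cover_le ab _; rewrite properEneq aA'.
  exact: subset_trans ba aA.
have high : {subset @component n cluster_tree B A <= [pred C : V | ~~ (val C \subset val A)]}.
  apply: comp_ind => [|a b _]; rewrite !inE.
    by case/andP: AB => /properP[_ [i iB iA]] _; apply/subsetPn; exists i.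
  move=> aA /orP[/andP[/proper_sub ab _]|ba] ne; apply: contra aA => bA.
    exact: subset_trans ab bA.
  have [e|bA'] := eqVneq (val b) (val A).
    have {e}e : b = A by apply: val_inj.
    by move: ne; rewrite e (cover_inj (etrans (congr1 (covers^~ a) (esym e)) ba) AB) eqxx.
  by apply: cover_le ba _; rewrite properEneq bA'.
have compE C : (C \in @component n cluster_tree A B) = (val C \subset val A).
  apply/idP/idP => [/low//|CA]; apply: contraLR CA => nC.
  by apply: high; rewrite (compC aAB) inE.
apply/setP=> i; rewrite in_side compE [val _]val_cluster_leaf.
case: eqVneq => [->|_]; last exact: sub1set.
have /andP[/properP[_ [j _ jA]] _] := AB.
rewrite subTset; apply/eqP/idP => [->|kA]; first by rewrite inE.
have := cluster_sub (valP A); case: eqVneq => // _ /(_ isT)/subsetP/(_ k kA).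
by rewrite !inE eqxx.
Qed.

Lemma splits_cluster_tree : splits cluster_tree = F.
Proof.
(* The clusters outside F do not give bounded edges: singletons are leaves, and the parent of the
   complement of k is the leaf k. *)
have cF A B : covers A B ->
    (val A \in F) = ~~ @is_leaf n cluster_tree A && ~~ @is_leaf n cluster_tree B.
  move=> AB; have /andP[pAB _] := AB.
  have BT : val B = setT -> val A = [set~ k].
    by move=> BT; apply/eqP; rewrite -covers_top -(_ : B = top) //; apply: val_inj.
  apply/idP/andP => [FA|[/cluster_leafP lA /cluster_leafP lB]].
    split; apply/cluster_leafP => -[|[i ik]].
    - by move=> AT; have := F_card (F_setC FA); rewrite AT setCT cards0.
    - by move=> Ai; have := F_card FA; rewrite Ai cards1.
    - by move/BT=> AX; have := F_card (F_setC FA); rewrite AX setCK cards1.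
    - by move=> Bi; have := proper_card pAB; rewrite Bi cards1 ltnNge ltnW // F_card.
  case/clustersP: (valP A) => [[]//|[i ik Ai]|AX|AT].
  - by case: lA; right; exists i.
  - case: lB; left; have : covers A top by rewrite covers_top AX.
    by move/(cover_inj AB)->.
  - by case: lA; left.
have sub A B : covers A B -> val A \in F ->
    exists x y : vert cluster_tree, bounded x y /\ val A = side x y.
  move=> AB FA; exists A, B; rewrite cluster_side //; split=> //.
  by rewrite boundedE -(cF _ _ AB) FA andbT /= /cover_adj AB.
apply/setP=> I; apply/splitsP/idP.
  case=> A [B [AB ->]]; move: (AB); rewrite boundedE => /and3P[/orP[sAB|sBA] lA lB].
    by rewrite cluster_side // (cF _ _ sAB) lA lB.
  have aBA : @adj n cluster_tree B A by rewrite /= /cover_adj sBA.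
  by rewrite (sideC aBA) F_setC // cluster_side // (cF _ _ sBA) lA lB.
have low J : J \in F -> k \notin J -> exists A B, covers A B /\ val A = J.
  move=> FJ kJ; have cJ : J \in clusters by apply/clustersP; constructor 1.
  have pJ : val (exist _ J cJ : V) \proper val top.
    by rewrite properT; apply: contraNneq kJ => /= ->; rewrite inE.
  by have [B AB _] := cover_up pJ; exists (exist _ J cJ), B.
move=> FI; have [kI|kI] := boolP (k \in I); last first.
  have [A [B [AB AI]]] := low I FI kI; exists A, B; rewrite cluster_side //; split=> //.
  by rewrite boundedE -(cF _ _ AB) AI FI andbT /= /cover_adj AB.
have FI' := F_setC FI; have kI' : k \notin ~: I by rewrite inE kI.
have [A [B [AB AI]]] := low _ FI' kI'.
have aAB : @adj n cluster_tree A B by rewrite /= /cover_adj AB.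
exists B, A; rewrite (sideC aAB) cluster_side // AI setCK bounded_sym; split=> //.
by rewrite boundedE -(cF _ _ AB) AI FI' andbT.
Qed.

End Buneman.

Lemma tree_of_splits (n : nat) (F : {set {set 'I_n}}) : (2 < n)%N ->
  (forall I, I \in F -> ~: I \in F) -> (forall I, I \in F -> (1 < #|I|)%N) ->
  (forall I J, I \in F -> J \in F -> compat I J) ->
  exists S : tree n, splits S = F.
Proof.
case: n F => // n F n_gt2 FC Fc Fi.
by exists (cluster_tree ord0 n_gt2 Fc Fi); apply: splits_cluster_tree.
Qed.

Local Open Scope ring_scope.

(** * The space Q_n and the function f_k *)

Section Qspace.
Variables (R : realType) (n : nat).
Local Notation D := {ffun pair2 n -> R^o}.
Local Notation Q := (Qspace R n).
Implicit Types (I J S : {set 'I_n}) (d : D).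

Lemma toQ_eq d d' : toQ d = toQ d' -> exists a : {ffun 'I_n -> R^o}, d = d' + Phi a.
Proof.
move/eqP; rewrite /toQ piE Quotient.equivE => /memv_imgP[a _ e].
by exists a; move: e; rewrite lfunE /= => <-; rewrite addrC subrK.
Qed.

Lemma toQ_Phi (a : {ffun 'I_n -> R^o}) : toQ (Phi a) = 0.
Proof.
rewrite -(linear0 (@toQ R n)); apply/eqP; rewrite /toQ piE Quotient.equivE subr0.
by apply/memv_imgP; exists a; rewrite ?memvf // lfunE.
Qed.

Lemma scalar_sum (U : lmodType R) (L : U -> R) (I : Type) (r : seq I) (P : pred I) c w :
  scalar L ->
  L (\sum_(i <- r | P i) c i *: w i) = \sum_(i <- r | P i) c i * L (w i).
Proof.
move=> hL; elim/big_rec2: _ => [|i y x _ <-]; last exact: hL.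
(* At -1, 0, 0 linearity reads L 0 = - L 0 + L 0, that is, L 0 = 0. *)
by have := hL (-1) 0 0; rewrite scaler0 addr0 mulN1r addNr.
Qed.

Lemma scalar0 (U : lmodType R) (L : U -> R) : scalar L -> L 0 = 0.
Proof. by move=> hL; have := hL (-1) 0 0; rewrite scaler0 addr0 mulN1r addNr. Qed.

Lemma scalarD (U : lmodType R) (L : U -> R) x y : scalar L -> L (x + y) = L x + L y.
Proof. by move=> hL; have := hL 1 x y; rewrite scale1r mul1r. Qed.

Lemma scalar_lift (g : D -> R) : scalar g -> (forall a, g (Phi a) = 0) ->
  exists2 L : Q -> R, scalar L & forall d, L (toQ d) = g d.
Proof.
move=> hg g0.
have wd d d' : toQ d = toQ d' -> g d = g d'.
  by case/toQ_eq=> a ->; rewrite (scalarD _ _ hg) g0 addr0.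
pose L (x : Q) := g (repr x).
have toQr (x : Q) : toQ (repr x) = x by exact: reprK.
exists L => [c x y|d]; last exact: wd.
by rewrite /L -hg; apply: wd; rewrite linearP /= !toQr.
Qed.

(** Extended by 0 to sets that are not pairs, so that a coordinate can be named by [[set i; j]]
    without a proof that it is a pair. *)
Definition pair_coord d S : R := if insub S is Some T then d (T : pair2 n) else 0.

Lemma pair_coordP c d d' S : pair_coord (c *: d + d') S = c * pair_coord d S + pair_coord d' S.
Proof. by rewrite /pair_coord; case: insub => [T|]; rewrite ?ffunE // mulr0 addr0. Qed.

Lemma pair_coordE (h : {set 'I_n} -> R^o) S :
  #|S| = 2%N -> pair_coord [ffun T => h (val T)] S = h S.
Proof. by move=> /eqP S2; rewrite /pair_coord insubT /= ffunE. Qed.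

Lemma pair_coord_Phi a S : #|S| = 2%N -> pair_coord (Phi a) S = \sum_(i in S) a i.
Proof. exact: (pair_coordE (fun S => \sum_(i in S) a i)). Qed.

Definition vrep I : D := [ffun T : pair2 n => (#|I :&: val T| == 1%N)%:R].

Lemma card_setI2 I (i j : 'I_n) : i != j ->
  #|I :&: [set i; j]| = ((i \in I) + (j \in I))%N.
Proof.
move=> ij; rewrite -sum1_card (eq_bigl (fun x => (x \in [set i; j]) && (x \in I))).
  by rewrite big_mkcondr big_setU1 ?inE //= big_set1; case: (i \in I); case: (j \in I).
by move=> x; rewrite inE andbC.
Qed.

Lemma pair2P (T : pair2 n) : exists i j, i != j /\ val T = [set i; j].
Proof. by have /cards2P[i [j [ij e]]] := valP T; exists i, j. Qed.

Lemma v_eq I J : (forall i j, i != j ->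
   ((i \in I) != (j \in I)) = ((i \in J) != (j \in J))) -> v_ R I = v_ R J.
Proof.
move=> h; congr toQ; apply/ffunP => T; rewrite !ffunE.
have [i [j [ij ->]]] := pair2P T; have := h i j ij; rewrite !card_setI2 //.
by do 4 case: (_ \in _).
Qed.

Lemma v_setC I : v_ R (~: I) = v_ R I.
Proof. by apply: v_eq => i j _; rewrite !inE; do 2 case: (_ \in _). Qed.

(* Modulo the image of Phi, v_I is -2 times this vector, and linear relations
   between these vectors are checked pair by pair. *)
Definition inner_pairs I : D := [ffun T : pair2 n => (val T \subset I)%:R].

(** For a pair T, the number of its elements in I is 1 if I separates T, 2 if T lies in I, and 0
    otherwise; as a function of T it is [Phi] of the indicator of I. *)
Lemma v_inner_pairs I : v_ R I = (-2) *: toQ (inner_pairs I).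
Proof.
rewrite -linearZ -[RHS]add0r -(toQ_Phi [ffun i => (i \in I)%:R]) -linearD.
congr toQ; apply/ffunP => T; rewrite !ffunE.
have [i [j [ij ->]]] := pair2P T; rewrite card_setI2 // subUset !sub1set.
rewrite big_setU1 ?inE //= big_set1 !ffunE.
by case: (i \in I); case: (j \in I) => /=; rewrite /GRing.scale /=; ring.
Qed.

Lemma v_set1 I : #|I| = 1%N -> v_ R I = 0.
Proof.
move=> I1; rewrite v_inner_pairs (_ : inner_pairs I = 0) ?linear0 ?scaler0 //.
apply/ffunP => T; rewrite !ffunE; case: (boolP (val T \subset I)) => // /subset_leq_card.
by rewrite I1 (eqP (valP T)).
Qed.

(** In terms of inner pairs, a pair within one of the three sets is counted twice on either side, a
    pair meeting two of them once, and any other pair not at all. *)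
Lemma v_balance (A B C : {set 'I_n}) :
  [disjoint A & B] -> [disjoint A & C] -> [disjoint B & C] ->
  v_ R (A :|: B) + v_ R (A :|: C) + v_ R (B :|: C) =
  v_ R A + v_ R B + v_ R C + v_ R (A :|: B :|: C).
Proof.
move=> AB AC' BC; rewrite !v_inner_pairs -!scalerDr -!linearD; congr (_ *: toQ _).
apply/ffunP => T; rewrite !ffunE.
have [i [j [_ ->]]] := pair2P T; rewrite !subUset !sub1set !inE.
have dis x : [/\ ~~ ((x \in A) && (x \in B)), ~~ ((x \in A) && (x \in C)) &
              ~~ ((x \in B) && (x \in C))].
  split; apply/negP => /andP[h1 h2].
  - by rewrite (disjointFr AB h1) in h2.
  - by rewrite (disjointFr AC' h1) in h2.
  - by rewrite (disjointFr BC h1) in h2.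
case: (dis i) (dis j) => + + + [].
case: (i \in A); case: (i \in B); case: (i \in C) => //=;
  case: (j \in A); case: (j \in B); case: (j \in C) => //= *; ring.
Qed.

(** * Gromov products and positive representations *)

Variable k : 'I_n.

Lemma V_P S : reflect (exists i j, [/\ i != j, i != k, j != k & S = [set i; j]]) (S \in V_ k).
Proof.
rewrite inE; apply: (iffP andP) => [[Sk /cards2P[i [j [ij e]]]]|[i [j [ij ik jk ->]]]].
  by exists i, j; move: Sk; rewrite e subUset !sub1set !inE => /andP[].
by rewrite subUset !sub1set !inE ik jk cards2 ij.
Qed.

Lemma v_sum_V I : k \notin I ->
  v_ R I = \sum_(S in V_ k) ((S \subset I)%:R : R) *: v_ R S.
Proof.
move=> kI; rewrite v_inner_pairs.
rewrite (eq_bigr (fun S => -2 *: (((S \subset I)%:R : R) *: toQ (inner_pairs S)))); last first.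
  by move=> S _; rewrite v_inner_pairs !scalerA mulrC.
rewrite -scaler_sumr; congr (_ *: _).
rewrite (eq_bigr (fun S => toQ ((S \subset I)%:R *: inner_pairs S))) => [|S _]; last first.
  by rewrite linearZ.
rewrite -linear_sum; congr toQ; apply/ffunP => T; rewrite sum_ffunE !ffunE.
(* For a pair S the vector [inner_pairs S] is the unit vector at S, and coordinates at pairs through
   k vanish because k is not in I. *)
have subV S : S \in V_ k -> (val T \subset S) = (S == val T).
  rewrite inE => /andP[_ /eqP S2]; rewrite eq_sym eqEcard S2 (eqP (valP T)) andbT //.
case: (boolP (val T \in V_ k)) => TV.
  rewrite (bigD1 (val T)) //= big1 => [|S /andP[SV ST]]; last first.
    by rewrite !ffunE subV // (negbTE ST) /GRing.scale /= mulr0.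
  by rewrite !ffunE subxx addr0 /GRing.scale /= mulr1.
rewrite big1 => [|S SV].
  case: (boolP (val T \subset I)) => // TI; move: TV; rewrite inE (valP T) andbT.
  by rewrite (subset_trans TI) // subsetC sub1set inE.
rewrite !ffunE subV //; case: eqP => [e|_]; first by rewrite -e SV in TV.
by rewrite /GRing.scale /= mulr0.
Qed.

(* The Gromov product of i and j with base point k, for S = {i, j}. *)
Definition gromov S d : R :=
  2^-1 * (\sum_(i in S) pair_coord d [set i; k] - pair_coord d S).

Lemma gromovP c d d' S : gromov S (c *: d + d') = c * gromov S d + gromov S d'.
Proof.
rewrite /gromov pair_coordP.
rewrite (eq_bigr (fun i => c * pair_coord d [set i; k] + pair_coord d' [set i; k])).
  by rewrite big_split /= -mulr_sumr; ring.
by move=> i _; rewrite pair_coordP.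
Qed.

Lemma gromov_Phi (a : {ffun 'I_n -> R^o}) S : S \in V_ k -> gromov S (Phi a) = a k.
Proof.
case/V_P=> i [j [ij ik jk ->]]; rewrite /gromov.
rewrite !(big_setU1, big_set1) ?inE //= !pair_coord_Phi ?cards2 ?ij ?ik ?jk //.
by rewrite !(big_setU1, big_set1) ?inE //=; field.
Qed.

Lemma gromov_v S I : S \in V_ k -> k \notin I -> gromov S (vrep I) = (S \subset I)%:R.
Proof.
case/V_P=> i [j [ij ik jk ->]] kI; rewrite /gromov.
rewrite !(big_setU1, big_set1) ?inE //=.
rewrite !(pair_coordE (fun T => (#|I :&: T| == 1%N)%:R)) ?cards2 ?ij ?ik ?jk //.
rewrite !card_setI2 // (negbTE kI) subUset !sub1set.
by case: (i \in I); case: (j \in I) => /=; field.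
Qed.

(** A single Gromov product does not descend to Q_n: its value on [Phi a] is [a k]. As this is the
    same for all pairs, differences do descend. *)
Lemma gromov_lift S S' : S \in V_ k -> S' \in V_ k ->
  exists2 L : Q -> R, scalar L &
    forall I, k \notin I -> L (v_ R I) = (S \subset I)%:R - (S' \subset I)%:R.
Proof.
move=> SV SV'; have [||L hL LE] := @scalar_lift (fun d => gromov S d - gromov S' d).
- by move=> c d d' /=; rewrite !gromovP; ring.
- by move=> a; rewrite !gromov_Phi // subrr.
- by exists L => // I kI; rewrite LE !gromov_v.
Qed.

Lemma V_notin S : S \in V_ k -> k \notin S.
Proof. by rewrite inE subsetC sub1set inE => /andP[]. Qed.

Lemma V_subset S S' : S \in V_ k -> S' \in V_ k -> (S \subset S') = (S == S').
Proof.
rewrite !inE => /andP[_ /eqP S2] /andP[_ /eqP S2'].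
by rewrite eqEcard S2 S2' andbT.
Qed.

Lemma positive_rep_diff x l S S' : positive_rep k x l -> S \in V_ k -> S' \in V_ k ->
  forall L : Q -> R, scalar L ->
  (forall I, k \notin I -> L (v_ R I) = (S \subset I)%:R - (S' \subset I)%:R) ->
  L x = l S - l S'.
Proof.
case=> -> _ _ SV SV' L hL LE; rewrite scalar_sum //.
have pick P : P \in V_ k -> \sum_(U in V_ k) l U * (P \subset U)%:R = l P.
  move=> PV; rewrite (bigD1 P) //= subxx mulr1 big1 ?addr0 // => U /andP[UV UP].
  by rewrite V_subset // eq_sym (negbTE UP) mulr0.
rewrite -(pick S) // -(pick S') // -sumrB; apply: eq_bigr => U UV.
by rewrite LE ?V_notin // mulrBr.
Qed.

Lemma f_positive_rep x l : positive_rep k x l -> f_ R k x = \sum_(S in V_ k) l S.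
Proof.
move=> pl; apply: xget_unique; first by exists l.
move=> r [l' pl' ->]; apply: eq_bigr => S SV.
(* At a zero Z of m the common difference gives m U = m' U - m' Z, and m' Z is nonnegative. *)
have le m m' U : positive_rep k x m -> positive_rep k x m' -> U \in V_ k -> m U <= m' U.
  move=> pm pm' UV; have [_ _ [Z ZV mZ]] := pm; have [_ pos _] := pm'.
  have [L hL LE] := gromov_lift UV ZV.
  have := positive_rep_diff pm UV ZV hL LE; rewrite (positive_rep_diff pm' UV ZV hL LE) mZ.
  by have := pos Z ZV; lra.
by apply/eqP; rewrite eq_le !le.
Qed.

Lemma card_V_subset I : k \notin I ->
  \sum_(S in V_ k) ((S \subset I)%:R : R) = 'C(#|I|, 2)%:R.
Proof.
move=> kI; rewrite -natr_sum; congr (_%:R).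
rewrite -cards_draws -sum1dep_card big_mkcond [RHS]big_mkcond /=; apply: eq_bigr => S _.
rewrite inE; case: (boolP (S \subset I)) => [SI|_]; last by case: ifP.
by rewrite (subset_trans SI) // subsetC sub1set inE.
Qed.

End Qspace.

(** * Cones *)

Section Cones.
Variables (R : realType) (n : nat).
Local Notation Q := (Qspace R n).
Implicit Types (I J S : {set 'I_n}) (F : {set {set 'I_n}}).

Definition span_cone F : set Q :=
  [set x | exists2 c : {set 'I_n} -> R, (forall I, 0 <= c I) &
           x = \sum_(I in F) c I *: v_ R I]%classic.

Lemma cone_span_cone (T : tree n) : @cone R n T = span_cone (splits T).
Proof. by []. Qed.

Lemma v_span_cone F I : I \in F -> span_cone F (v_ R I).
Proof.
move=> IF; exists (fun J => (J == I)%:R) => [J|]; first exact: ler0n.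
rewrite (bigD1 I) //= eqxx scale1r big1 ?addr0 // => J /andP[_ /negbTE->].
by rewrite scale0r.
Qed.

Lemma span_coneS F F' : F \subset F' -> (span_cone F `<=` span_cone F')%classic.
Proof.
move=> FF x [c c0 ->]; exists (fun I => if I \in F then c I else 0).
  by move=> I; case: ifP.
rewrite [RHS](bigID (mem F)) /= [X in _ + X]big1 ?addr0 => [|I /andP[_ /negbTE->]]; last first.
  by rewrite scale0r.
rewrite [RHS](eq_bigr (fun I => c I *: v_ R I)) => [|I /andP[_ ->]] //.
by apply: eq_bigl => I; rewrite andb_idl // => /(subsetP FF).
Qed.

(* d(i,p) + d(j,q) - d(i,j) - d(p,q); it is 2 on v_I if I separates ij from pq. *)
Definition quartet (bi bj bp bq : bool) : R :=
  (bi != bp)%:R + (bj != bq)%:R - (bi != bj)%:R - (bp != bq)%:R.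

Lemma quartet_lift (i j p q : 'I_n) : i != j -> p != q -> i != p -> j != q ->
  exists2 L : Q -> R, scalar L &
  forall I, L (v_ R I) = quartet (i \in I) (j \in I) (p \in I) (q \in I).
Proof.
move=> ij pq ip jq.
have [||L hL LE] := @scalar_lift R n (fun d => pair_coord d [set i; p] + pair_coord d [set j; q]
   - pair_coord d [set i; j] - pair_coord d [set p; q]).
- by move=> c d d' /=; rewrite !pair_coordP; ring.
- move=> a; rewrite !pair_coord_Phi ?cards2 ?ij ?pq ?ip ?jq //.
  by rewrite !(big_setU1, big_set1) ?inE //=; ring.
- exists L => // I; rewrite LE.
  rewrite !(pair_coordE (fun T => (#|I :&: T| == 1%N)%:R)) ?cards2 ?ij ?pq ?ip ?jq //.
  by rewrite !card_setI2 // /quartet; do 4 case: (_ \in I).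
Qed.

(** The quartet is negative only if I separates ip from jq; then I and J would cut each other into
    four nonempty parts. *)
Lemma quartet_compat I J i j p q : compat I J -> i \in J -> j \in J -> p \notin J -> q \notin J ->
  0 <= quartet (i \in I) (j \in I) (p \in I) (q \in I).
Proof.
move=> cIJ iJ jJ pJ qJ; rewrite /quartet.
case/or4P: cIJ => /subsetP h; have := h i; have := h j; have := h p; have := h q;
  rewrite ?inE iJ jJ (negbTE pJ) (negbTE qJ);
  case: (i \in I); case: (j \in I); case: (p \in I); case: (q \in I) => /= h1 h2 h3 h4;
  try (by have := h1 isT); try (by have := h2 isT); try (by have := h3 isT);
  try (by have := h4 isT); lra.
Qed.

Lemma quartet_gt0 (bi bj bp bq : bool) :
  0 < quartet bi bj bp bq -> [/\ bi = bj, bp = bq & bi != bp].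
Proof. by case: bi bj bp bq => [] [] [] [] //=; rewrite /quartet /=; lra. Qed.

(** Let I0 have a positive coefficient in v_J. A quartet functional across I0 is positive on v_I0
    and nonnegative on the other generators, so it is positive on v_J, and J separates every two
    labels of I0 from every two outside. This forces J to be I0 or its complement. *)
Lemma v_in_span_cone F J :
  (forall I, I \in F -> ~: I \in F) -> (forall I, I \in F -> (1 < #|I|)%N) ->
  (forall I I', I \in F -> I' \in F -> compat I I') ->
  (1 < #|J|)%N -> (1 < #|~: J|)%N -> span_cone F (v_ R J) -> J \in F.
Proof.
move=> FC Fc Fi J1 J2 [c c0 vJ].
(* Without a positive coefficient v_J would be zero, but a quartet functional across J takes the
   value 2 on it. *)
have [I0 /andP[IF cI]|no] := pickP [pred I in F | 0 < c I]; last first.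
  have [i [j [iJ jJ ij]]] := card_gt1P J1; have [p [q [pJ qJ pq]]] := card_gt1P J2.
  have ne x y : x \in J -> y \in ~: J -> x != y.
    by move=> xJ; apply: contraTneq => <-; rewrite inE xJ.
  have [L hL LE] := quartet_lift ij pq (ne _ _ iJ pJ) (ne _ _ jJ qJ).
  have := LE J; rewrite vJ big1 => [|I IF].
    rewrite scalar0 // iJ jJ; move: pJ qJ; rewrite !inE => /negbTE-> /negbTE->.
    by rewrite /quartet /=; lra.
  have := no I; rewrite /= IF /= lt_neqAle c0 andbT => /negbFE/eqP<-.
  exact: scale0r.
have key i j p q : i \in I0 -> j \in I0 -> i != j -> p \notin I0 -> q \notin I0 -> p != q ->
    [/\ (i \in J) = (j \in J), (p \in J) = (q \in J) & (i \in J) != (p \in J)].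
  move=> iI jI ij pI qI pq; apply: quartet_gt0.
  have ne x y : x \in I0 -> y \notin I0 -> x != y.
    by move=> xI; apply: contraNneq => <-.
  have [L hL LE] := quartet_lift ij pq (ne _ _ iI pI) (ne _ _ jI qI).
  rewrite -LE vJ scalar_sum // (bigD1 I0) //= LE iI jI (negbTE pI) (negbTE qI).
  apply: ltr_pwDl; first by rewrite mulr_gt0 // /quartet /=; lra.
  apply: sumr_ge0 => I /andP[IF' _]; rewrite LE mulr_ge0 //.
  by apply: (quartet_compat (J := I0)) => //; apply: Fi.
have I1 := Fc _ IF; have I2 := Fc _ (FC _ IF).
have [i [j [iI jI ij]]] := card_gt1P I1; have [p [q [pI qI pq]]] := card_gt1P I2.
rewrite !inE in pI qI.
have [_ _ ip] := key i j p q iI jI ij pI qI pq.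
have inI x : x \in I0 -> (x \in J) = (i \in J).
  move=> xI; have [->//|xi] := eqVneq x i.
  by have [->] := key x i p q xI iI xi pI qI pq.
have outI x : x \notin I0 -> (x \in J) = (p \in J).
  move=> xI; have [->//|xp] := eqVneq x p.
  by have [_ -> _] := key i j x p iI jI ij xI pI xp.
have [iJ|iJ] := boolP (i \in J).
  rewrite (_ : J = I0) //; apply/setP=> x; case: (boolP (x \in I0)) => [/inI->//|/outI->].
  by move: ip; rewrite iJ; case: (p \in J).
rewrite (_ : J = ~: I0) ?FC //; apply/setP=> x; rewrite inE.
case: (boolP (x \in I0)) => [/inI->|/outI->]; first by rewrite (negbTE iJ).
by move: ip; rewrite (negbTE iJ); case: (p \in J).
Qed.

Hypothesis n_gt2 : (2 < n)%N.

Lemma cone_subset_splits (S T : tree n) : (@cone R n T `<=` @cone R n S)%classic ->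
  splits T \subset splits S.
Proof.
move=> TS; apply/subsetP => J JT.
apply: v_in_span_cone; last by apply: TS; apply: v_span_cone.
- exact: splits_setC.
- exact: splits_card.
- exact: splits_compat.
- exact: splits_card JT.
- exact: splits_card (splits_setC JT).
Qed.

Lemma cone_inj_splits (S T : tree n) : @cone R n T = @cone R n S -> splits T = splits S.
Proof.
by move=> e; apply/eqP; rewrite eqEsubset !cone_subset_splits // e.
Qed.

(** * The function f_k on the cones *)

Variable k : 'I_n.

Definition away I := if k \in I then ~: I else I.

Lemma away_notin I : k \notin away I.
Proof. by rewrite /away; case: ifP => h; rewrite ?inE h. Qed.

Lemma v_away I : v_ R (away I) = v_ R I.
Proof. by rewrite /away; case: ifP; rewrite ?v_setC. Qed.

Lemma away_splits (T : tree n) I : I \in splits T -> away I \in splits T.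
Proof. by rewrite /away; case: ifP => // _; apply: splits_setC. Qed.

(** Expanding each v_I over the pairs inside its side without k gives nonnegative coefficients, and
    the separated pair gets coefficient zero. The representation is thus positive and computes
    f_k. *)
Lemma f_span_cone (T : tree n) c : (forall I, 0 <= c I) ->
  f_ R k (\sum_(I in splits T) c I *: v_ R I) =
  \sum_(I in splits T) c I * 'C(#|away I|, 2)%:R.
Proof.
move=> c0; have [i [j [ij ik jk sep]]] := separated_pair T n_gt2 k.
rewrite (@f_positive_rep _ _ _ _ (fun S => \sum_(I in splits T) c I * (S \subset away I)%:R)).
  rewrite exchange_big /=; apply: eq_bigr => I _.
  by rewrite -mulr_sumr card_V_subset ?away_notin.
split=> [|S _|].
- rewrite [RHS](eq_bigr (fun S => \sum_(I in splits T)
    (c I * (S \subset away I)%:R) *: v_ R S)) => [|S _]; last by rewrite scaler_suml.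
  rewrite exchange_big /=; apply: eq_bigr => I _.
  rewrite -v_away (v_sum_V R (away_notin I)) scaler_sumr.
  by apply: eq_bigr => S _; rewrite scalerA.
- by apply: sumr_ge0 => I _; rewrite mulr_ge0.
- exists [set i; j]; first by apply/V_P; exists i, j.
  rewrite big1 // => I IT; rewrite subUset !sub1set.
  by rewrite (negbTE (sep _ (away_splits IT) (away_notin _))) mulr0.
Qed.

(** The extension is the sum over S in V_k of the coefficient of S minus that of the separated pair;
    the latter vanishes on the cone. *)
Lemma f_linear_on_cone (T : tree n) :
  exists2 L : Q -> R, scalar L & {in @cone R n T, L =1 f_ R k}.
Proof.
have [i [j [ij ik jk sep]]] := separated_pair T n_gt2 k.
have S0V : [set i; j] \in V_ k by apply/V_P; exists i, j.
have /choice[L HL] : forall S, exists L : Q -> R, S \in V_ k -> scalar L /\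
    forall I, k \notin I -> L (v_ R I) = (S \subset I)%:R - ([set i; j] \subset I)%:R.
  move=> S; have [SV|_] := boolP (S \in V_ k); last by exists (fun=> 0).
  by have [L hL LE] := gromov_lift R SV S0V; exists L.
pose M x := \sum_(S in V_ k) L S x.
have hM : scalar M.
  move=> c x y; rewrite /M mulr_sumr -big_split /=; apply: eq_bigr => S SV.
  by have [-> _] := HL S SV.
exists M => // x /set_mem[c c0 ->]; rewrite f_span_cone // scalar_sum //.
apply: eq_bigr => I IT; congr (_ * _); rewrite -v_away /M -(card_V_subset R (away_notin I)).
apply: eq_bigr => S SV; have [_ ->] := HL S SV; last exact: away_notin.
by rewrite subUset !sub1set (negbTE (sep _ (away_splits IT) (away_notin _))) subr0.
Qed.

Lemma linear_on_cone (T : tree n) (L := linear_on (f_ R k) (@cone R n T)) :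
  scalar L /\ forall I, I \in splits T -> k \notin I -> L (v_ R I) = 'C(#|I|, 2)%:R.
Proof.
have [M hM ME] := f_linear_on_cone T.
have [hL LE] : scalar L /\ {in @cone R n T, L =1 f_ R k}.
  (* A linear extension exists, so [xget] does not return its default. *)
  by rewrite /L /linear_on; case: xgetP => [M' _ //|/(_ M)[]].
split=> // I IT kI; rewrite LE; last by apply: mem_set; apply: v_span_cone.
rewrite -(_ : \sum_(J in splits T) ((J == I)%:R : R) *: v_ R J = v_ R I).
  rewrite f_span_cone => [|J]; last exact: ler0n.
  rewrite (bigD1 I) //= eqxx mul1r big1 => [|J /andP[_ /negbTE->]]; last exact: mul0r.
  by rewrite addr0 /away (negbTE kI).
rewrite (bigD1 I) //= eqxx scale1r big1 ?addr0 // => J /andP[_ /negbTE->].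
exact: scale0r.
Qed.

End Cones.

(** * The star of a cone of codimension one *)

Section Star.
Variables (R : realType) (n : nat) (k : 'I_n) (T : tree n).
Hypotheses (n_gt2 : (2 < n)%N) (codim1T : (nb_bounded T + 4 = n)%N).
Implicit Types I J : {set 'I_n}.

Definition add_split J := J |: (~: J |: splits T).

Lemma compat_sym I J : compat I J = compat J I.
Proof.
rewrite /compat [J \subset ~: I]subsetC [~: J \subset I]subCset !setCS.
by case: (I \subset J); case: (J \subset I); rewrite ?orbT //= !orbF.
Qed.

Lemma compat_setC I J : compat (~: I) J = compat I J.
Proof.
rewrite /compat setCK.
by case: (I \subset J); case: (I \subset ~: J); case: (~: I \subset J); case: (~: I \subset ~: J).
Qed.

Lemma setC_neq J : J != ~: J.
Proof.
apply/eqP => /setP/(_ k); rewrite inE; by case: (k \in J).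
Qed.

Lemma card_add_split J : J \notin splits T -> #|add_split J| = (n - 3).*2.
Proof.
move=> nJ; have nJ' : ~: J \notin splits T.
  by apply: contra nJ => /splits_setC; rewrite setCK.
rewrite !cardsU1 !inE negb_or setC_neq nJ nJ' card_splits.
have -> : (n - 3)%N = (nb_bounded T).+1 by have := codim1T; lia.
by rewrite doubleS.
Qed.

Lemma add_split_tree J : addable T J ->
  exists2 S : tree n, splits S = add_split J & nb_bounded S = (n - 3)%N.
Proof.
case=> J1 J2 nJ cJ.
have [|||S SE] := @tree_of_splits n (add_split J) n_gt2.
- move=> I; rewrite !inE => /or3P[/eqP->|/eqP->|/splits_setC->].
  + by rewrite eqxx orbT.
  + by rewrite setCK eqxx.
  + by rewrite !orbT.
- by move=> I; rewrite !inE => /or3P[/eqP->|/eqP->|/splits_card].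
- have cc I : compat I I by rewrite /compat subxx.
  move=> I I'; rewrite !inE => /or3P[/eqP->|/eqP->|IT] /or3P[/eqP->|/eqP->|IT'];
    rewrite ?compat_setC ?[compat _ (~: _)]compat_sym ?compat_setC //.
  + by rewrite compat_sym cJ.
  + by rewrite compat_sym cJ.
  + exact: cJ.
  + by rewrite compat_sym cJ.
  + exact: splits_compat IT IT'.
exists S => //; apply: double_inj; rewrite -card_splits SE; exact: card_add_split.
Qed.

(** Trees with equal cones have equal splits, so whichever trees are chosen, the new split is J or
    its complement, and both have the same vector. *)
Lemma primitive_add_split J : addable T J ->
  primitive (@span_cone R n (add_split J)) (@cone R n T) = v_ R J.
Proof.
move=> aJ; have [S SE _] := add_split_tree aJ; have [_ _ nJ _] := aJ.
apply: xget_unique.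
  exists S, T, J; split=> //; first by rewrite -SE.
  by rewrite inE nJ SE !inE eqxx.
move=> _ [S' [T' [I [eS eT IST ->]]]].
have eS' : splits S' = add_split J.
  rewrite -SE; apply: (@cone_inj_splits R) => //.
  by rewrite -eS -SE.
have eT' : splits T' = splits T by apply: (@cone_inj_splits R).
move: IST; rewrite inE eS' eT' !inE => /andP[nI /or3P[/eqP->//|/eqP->|IT]].
  exact: v_setC.
by rewrite IT in nI.
Qed.

(** S has one bounded edge more than T, hence just two further sides, a set and its complement; J is
    the one without k. *)
Lemma facet_add_split (S : tree n) : splits T \subset splits S -> nb_bounded S = (n - 3)%N ->
  exists J, [/\ k \notin J, addable T J & splits S = add_split J].
Proof.
move=> TS nS.
have /properP[_ [I IS nI]] : splits T \proper splits S.
  by rewrite properEcard TS !card_splits nS ltn_double; have := codim1T; lia.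
exists (away k I); have aS := away_splits k IS.
have naT : away k I \notin splits T.
  by apply: contra nI; rewrite /away; case: ifP => // _ /splits_setC; rewrite setCK.
split; first exact: away_notin.
  split=> // [||I' I'T]; [exact: splits_card aS|exact: splits_card (splits_setC aS)|].
  by apply: splits_compat aS; apply: (subsetP TS).
apply/esym/eqP; rewrite eqEcard card_add_split // card_splits nS leqnn andbT.
by rewrite !subUset !sub1set aS splits_setC.
Qed.

Lemma starE (Js : seq {set 'I_n}) : (forall J, k \notin J -> addable T J <-> J \in Js) ->
  (forall J, J \in Js -> k \notin J) ->
  star (@cone R n T) = [set` [seq @span_cone R n (add_split J) | J <- Js]]%classic.
Proof.
move=> JsE kJs; apply/seteqP; split=> s /=.
  case=> -[S nS ->] sub.
  have [J [kJ aJ SJ]] := facet_add_split (cone_subset_splits sub) nS.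
  by apply/mapP; exists J; [apply/JsE|rewrite cone_span_cone SJ].
case/mapP=> J JJs ->; have /(JsE _ (kJs _ JJs))[] := JJs => J1 J2 nJ cJ.
have [S SE nS] := add_split_tree (And4 J1 J2 nJ cJ).
split; first by exists S; rewrite ?cone_span_cone ?SE.
by apply: span_coneS; rewrite /add_split setUA subsetUr.
Qed.

(** J and its complement span the same facet with T, so avoiding k is what makes the listing of the
    star free of repetitions. *)
Lemma add_split_inj J J' : k \notin J -> k \notin J' -> addable T J -> addable T J' ->
  @span_cone R n (add_split J) = @span_cone R n (add_split J') -> J = J'.
Proof.
move=> kJ kJ' aJ aJ' e; have [_ _ nJ _] := aJ.
have [S SE _] := add_split_tree aJ; have [S' SE' _] := add_split_tree aJ'.
have : splits S = splits S' by apply: (@cone_inj_splits R); rewrite // !cone_span_cone SE SE'.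
rewrite SE SE' => /setP/(_ J); rewrite !inE eqxx (negbTE nJ) !orbF /=.
by case/esym/orP => /eqP // eJ; move: kJ; rewrite eJ inE kJ'.
Qed.

Lemma weight_cone (Js : seq {set 'I_n}) : uniq Js ->
  (forall J, k \notin J -> addable T J <-> J \in Js) ->
  (forall J, J \in Js -> k \notin J) ->
  weight (f_ R k) (@cone R n T) = \sum_(J <- Js) 'C(#|J|, 2)%:R
    - linear_on (f_ R k) (@cone R n T) (\sum_(J <- Js) v_ R J).
Proof.
move=> uJs JsE kJs; have aJs J : J \in Js -> addable T J.
  by move=> JJs; apply/(JsE _ (kJs _ JJs)).
have uS : uniq [seq @span_cone R n (add_split J) | J <- Js].
  rewrite map_inj_in_uniq // => J J' JJs JJs'.
  by apply: add_split_inj; rewrite ?kJs //; apply: aJs.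
have eP : \sum_(J <- Js) primitive (@span_cone R n (add_split J)) (@cone R n T) =
    \sum_(J <- Js) v_ R J.
  by apply: eq_big_seq => J /aJs; apply: primitive_add_split.
rewrite /weight (starE JsE kJs) -!fsbig_seq // !big_map eP; congr (_ - _).
apply: eq_big_seq => J JJs; rewrite primitive_add_split; last exact: aJs.
have [S SE _] := add_split_tree (aJs _ JJs).
have [_] := linear_on_cone R n_gt2 k S; rewrite cone_span_cone SE; apply; last exact: kJs.
by rewrite !inE eqxx.
Qed.

Lemma bin2D a b : 'C(a + b, 2) = ('C(a, 2) + 'C(b, 2) + a * b)%N.
Proof.
elim: a => [|a IHa]; first by rewrite addn0.
by rewrite addSn !binS !bin1 IHa; lia.
Qed.

Lemma weight_codim1 : weight (f_ R k) (@cone R n T) =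
  if `[< exists2 x, adj (leaf T k) x & valence x = 4 >] then 'C(n.-1, 2)%:R else 0.
Proof.
have [A [B [C [[dAB dAC dBC kD] UT [n1 n2 n3] aE DE]]]] := codim1_star n_gt2 k codim1T.
set D := ~: _ in kD UT DE.
have := kD; rewrite !inE !negb_or -andbA => /and3P[kA kB kC].
rewrite (@weight_cone [:: A :|: B; A :|: C; B :|: C]) //; first last.
- by move=> J; rewrite !inE => /or3P[]/eqP->; rewrite !inE negb_or ?kA ?kB ?kC.
- by rewrite /= !inE negb_or n1 n2 n3.
have [hL LE] := linear_on_cone R n_gt2 k T.
set L := linear_on _ _ in hL LE *.
(* Nothing is known of L outside the cone of T, so the balancing relation first moves its argument
   into the span of that cone. *)
rewrite !big_cons !big_nil !addr0 !addrA v_balance // !(scalarD _ _ hL).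
have LU U : U \in [:: A; B; C] -> k \notin U -> L (v_ R U) = 'C(#|U|, 2)%:R.
  move=> hU kU; have [|/LE->//|U1] := UT U.
    by move: hU; rewrite !inE => /or3P[]->; rewrite ?orbT.
  by rewrite v_set1 // scalar0 // U1.
rewrite (LU A) ?(LU B) ?(LU C) ?inE ?eqxx ?orbT //.
have -> : L (v_ R (A :|: B :|: C)) =
    if `[< exists2 x, adj (leaf T k) x & valence x = 4 >] then 0 else 'C(#|A :|: B :|: C|, 2)%:R.
  case: asboolP => [/DE D1|nD]; first by rewrite -v_setC v_set1 // scalar0.
  have [||D1] := UT D; [by rewrite !inE eqxx !orbT| |by case: nD; apply/DE].
  by move/splits_setC; rewrite setCK => /LE->//; rewrite -[_ :|: C]setCK inE kD.
have cU (X Y : {set 'I_n}) : [disjoint X & Y] -> #|X :|: Y| = (#|X| + #|Y|)%N.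
  by move=> XY; apply/eqP; have [_ ->] := leq_card_setU X Y.
have dABC : [disjoint A :|: B & C] by rewrite disjoints_subset subUset -!disjoints_subset dAC.
rewrite !cU //; case: asboolP => [/DE D1|_]; last first.
  by rewrite !bin2D mulnDl !natrD; ring.
have -> : n.-1 = (#|A| + #|B| + #|C|)%N.
  by have := cardsC D; rewrite D1 setCK !cU // card_ord => /(congr1 predn) /= <-.
by rewrite !bin2D mulnDl !natrD; ring.
Qed.

End Star.

Theorem proposition3p5 (R : realType) (n : nat) (hn : (3 <= n)%N) (k : 'I_n) :
  divisor (f_ R k) = scale_fan ('C(n.-1, 2)%:R : R) (Psi R k).
Proof.
apply/seteqP; split=> [[t w]|_ [[t w] [T [nT val4 /= tE wE]] <-]] /=.
  case=> /= -[r rn [T nT ->]] ->.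
  (* The subtraction is truncated, but r + 1 = n - 3 forces n to be at least 4. *)
  have codim1T : (nb_bounded T + 4 = n)%N by move: rn; rewrite nT; lia.
  rewrite (weight_codim1 R k hn codim1T); case: asboolP => [ex _|_]; last by rewrite eqxx.
  by exists (@cone R n T, 1); [exists T|rewrite /= mulr1].
rewrite tE wE mulr1; split=> /=.
- by exists (nb_bounded T); [lia|exists T].
- by rewrite (weight_codim1 R k hn nT); case: asboolP.
(* As n - 1 is at least 2, the weight is nonzero and no cone of Psi_k is discarded. *)
- by rewrite pnatr_eq0 -lt0n bin_gt0; lia.
Qed.
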